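(* Let $k\ge 1$ be an integer and let $f(z)=z+c_1z^2+c_2z^3+\dots$ be univalent in the disk $|z|<1$. Let $L_{-k}(f)$ denote the tangent vector at $f$ of the vector field $L_{-k}$ on the space $\mathfrak K$ of normalized univalent functions, i.e. the function of $z$ given by $$L_{-k}(f)(z)=\frac{f(z)^2}{2\pi i}\int_{|t|=r}\frac{f'(t)^2\, t^{1-k}\,dt}{f(t)^2\,(f(t)-f(z))},\qquad |z|<r<1 .$$ Then $L_{-k}(f)$ is given by $$L_{-k}(f)(z)=\sum_{j=0}^\infty\ \ \sum_{\mathbf m:\,\|\mathbf m\|= j+k+1} \mathfrak a_{\mathbf m}(j+1)\, \frac{c^{\mathbf m}}{\prod_i m_i!}\, f(z)^{j+2}$$ (for $z$ in a neighbourhood of $0$, equivalently as an identity of power series in $z$), and also by $$L_{-k}(f)(z)=z^{1-k}f'(z)- \sum_{j=0}^{k}\ \ \sum_{\mathbf m:\,\|\mathbf m\|= k-j} \mathfrak a_{\mathbf m}(-j)\,\frac{c^{\mathbf m}}{\prod_i m_i!}\, f(z)^{1-j}\qquad (0<|z|<1).$$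
   Context: $\mathfrak K$ is the space of functions $f(z)=z+c_1z^2+c_2z^3+\dots$ univalent (holomorphic and injective) in $|z|<1$. The Lie algebra of vector fields on the circle acts on $\mathfrak K$ by Kirillov's vector fields: to $v(z)\frac{\partial}{\partial z}$ corresponds at $f$ the tangent vector (a function of $z$) $\frac{f(z)^2}{2\pi i}\int\frac{f'(t)^2v(t)\,dt}{f(t)^2(f(t)-f(z))}$, the integral being over a circle $|t|=r$ close to the unit circle and enclosing $z$; $L_{-k}$ corresponds to $v(t)=t^{1-k}$. The value of the integral does not depend on $r\in(|z|,1)$. Here $\mathbf m=(m_1,m_2,\dots)$ runs over sequences of nonnegative integers with finitely many nonzero entries, $c^{\mathbf m}=c_1^{m_1}c_2^{m_2}\cdots$, $|\mathbf m|=\sum_i m_i$, $\|\mathbf m\|=M_1=\sum_i i\,m_i$, $M_2=\sum_i i^2m_i$. The coefficients are $\mathfrak a_0(p)=1$ and, for $\mathbf m\ne0$, $$\mathfrak a_{\mathbf m}(p)=(-1)^{|\mathbf m|}\frac{(p+|\mathbf m|-1)!}{(p+1)!}\Bigl\{p(p+1)+M_1^2-2(p+1)M_1-M_2\Bigr\},$$ where $\frac{(p+n-1)!}{(p+1)!}$ is read as $(p+2)(p+3)\cdots(p+n-1)$ for $n\ge2$ (equal to $1$ for $n=2$), and for $|\mathbf m|=1$ (where the bracket equals $(p+1)(p-2M_1)$ and the factorial ratio is $\frac1{p+1}$) $\mathfrak a_{\mathbf m}(p)$ is read as $2M_1-p$ for all $p$, including $p=-1$. *)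

(* Defs.v *)
From mathcomp Require Import all_boot.
From Stdlib Require Import Reals ZArith.
From Coquelicot Require Import Coquelicot.

Set Implicit Arguments.
Unset Strict Implicit.
Unset Printing Implicit Defensive.

(* [/ 0] is a junk value, so negative powers are meaningful for z <> 0 only. *)
Definition CpowZ (z : C) (n : Z) : C :=
  match n with
  | Z0 => RtoC 1
  | Zpos q => (z ^ Pos.to_nat q)%C
  | Zneg q => (/ (z ^ Pos.to_nat q))%C
  end.

(* f belongs to the space of univalent functions z + c_1 z^2 + c_2 z^3 + ...
   on the unit disc; the value [c 0] is not used. *)
Definition univalent_normalized (f : C -> C) (c : nat -> C) : Prop :=
  (forall z : C, (Cmod z < 1)%R ->
     ex_derive (K := C_AbsRing) (V := C_NormedModule) f z) /\
  (forall z w : C, (Cmod z < 1)%R -> (Cmod w < 1)%R -> f z = f w -> z = w) /\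
  (forall z : C, (Cmod z < 1)%R ->
     is_series (K := C_AbsRing) (V := C_NormedModule)
       (fun n : nat => (c n.+1 * z ^ n.+2)%C) (f z - z)%C).

(* The integral of g(t) dt over the circle |t| = r, with t = r e^(i theta). *)
Definition circle_integral (g : C -> C) (r : R) : C :=
  RInt (V := C_R_CompleteNormedModule)
    (fun theta : R =>
       let t : C := (RtoC r * (cos theta, sin theta))%C in
       (g t * (Ci * t))%C)
    0%R (2 * PI)%R.

(* The tangent vector at f of the vector field v(z) d/dz, as a function of z;
   the integral does not depend on the choice of r between |z| and 1. *)
Definition kirillov_field (v : C -> C) (f : C -> C) (r : R) (z : C) : C :=
  (f z ^ 2 / (RtoC 2 * RtoC PI * Ci) *
   circle_integral
     (fun t : C => C_derive f t ^ 2 * v t / (f t ^ 2 * (f t - f z))) r)%C.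

(* L_{-k}, which corresponds to v(t) = t^(1-k). *)
Definition L_minus (k : nat) (f : C -> C) (r : R) (z : C) : C :=
  kirillov_field (fun t : C => CpowZ t (1 - Z.of_nat k)%Z) f r z.

(* Multi-indices: [m i] stands for m_(i+1).  If ||m|| = N then m_i <= N for all
   i and m_i = 0 for i > N, so the sequences m with ||m|| = N are exactly the
   elements of [multi_index N] with [mweight m = N]. *)
Definition multi_index (N : nat) : finType := {ffun 'I_N -> 'I_N.+1}.

Section MultiIndex.
Variables (N : nat) (m : multi_index N).

Definition msize : nat := (\sum_(i < N) m i)%nat.                  (* |m| *)
Definition mweight : nat := (\sum_(i < N) i.+1 * m i)%nat.         (* ||m|| = M_1 *)
Definition mweight2 : nat := (\sum_(i < N) expn i.+1 2 * m i)%nat.    (* M_2 *)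
Definition mfact : nat := (\prod_(i < N) (m i)`!)%nat.
Definition mmonomial (c : nat -> C) : C :=
  \big[Cmult/RtoC 1]_(i < N) (c i.+1 ^ m i)%C.

(* The case |m| = 1 is the value of the general formula after cancelling p+1,
   so it is also meant for p = -1; in the last case (p+|m|-1)!/(p+1)! is read
   as the product (p+2)...(p+|m|-1), for p of any sign. *)
Definition acoef (p : Z) : Z :=
  let M1 := Z.of_nat mweight in
  let M2 := Z.of_nat mweight2 in
  match msize with
  | 0%nat => 1
  | 1%nat => 2 * M1 - p
  | n => (-1) ^ Z.of_nat n
         * (\big[Z.mul/1%Z]_(2 <= i < n) (p + Z.of_nat i)%Z)
         * (p * (p + 1) + M1 ^ 2 - 2 * (p + 1) * M1 - M2)
  end%Z.

End MultiIndex.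

Definition acoef_sum (c : nat -> C) (N : nat) (p : Z) : C :=
  \big[Cplus/RtoC 0]_(m : multi_index N | mweight m == N)
    (RtoC (IZR (acoef m p)) * (mmonomial m c / RtoC (INR (mfact m))))%C.

(* Main.v *)
Require Import Defs.
From HB Require Import structures.
From mathcomp Require Import all_boot.
From Stdlib Require Import Reals ZArith Lra Lia Psatz.
From Coquelicot Require Import Coquelicot.
From mathcomp Require Import zify_ssreflect.

(** Write [w = f z], [f t = t g(t)], and let A_N(p) be the sum of
[a_m(p) c^m / m!] over the multi-indices [m] of weight N.  The tangent vector
[L_{-k}(f)(z)] is [w^2] times the mean over the circle [|t| = r] of
[f'(t)^2 / (t^k g(t)^2 (f(t) - w))], and everything rests on two facts.

Algebra: A_N(p) is the N-th Taylor coefficient of [f'^2 g^(-p-2)], for every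
integer p of either sign ([coefs_power_kernel]).  In p = -2 the generating
series of A_N is [f'^2], because the product (p+2)...(p+|m|-1) vanishes for
|m| > 2 ([acoef_sum_m2]).  Passing from p to p-1 multiplies the generating
series by g ([acoef_sum_pred]): adding one unit to an entry of m is a bijection
between multi-indices, and the resulting identity between the numbers a_m(p) is
polynomial in |m|, M_1 and M_2 ([acoef_of_pred]).  As [g(0) = 1], this recursion
can be run in both directions, so that p = -2 determines all p.

Analysis: the mean over a circle of a function holomorphic on an annulus does
not depend on the radius ([mean_const]), and on a disc it is the value at the
centre ([mean_disc]).  For z near 0, the contour is moved to a fixed circle on
which |w| is at most |f(t)| / 2; there [1/(f(t) - w)] is the geometric series in
[w / f(t)], and its term of index j contributes A_(j+k+1)(j+1) [w^j].  For the
second formula the contour is moved inside |t| = |z|.  Crossing z yields the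
residue term [z^(1-k) f'(z)] ([mean_integrand_cross]); inside, the first k+1
terms of the expansion of [1/(f(t) - w)] in powers of [f(t) / w] contribute
A_(k-j)(-j), and the remainder is [t] times a function holomorphic in
[|t| < |z|], hence has mean 0.

For the residue, write [f - w = (t - z)^m q] with [q(z)] nonzero
([finite_order]).  It comes out as m times [z^(1-k) f'(z)], and either m = 1 or
[f'(z) = 0]. *)

Set Implicit Arguments.
Unset Strict Implicit.
Unset Printing Implicit Defensive.

Local Open Scope nat_scope.

HB.instance Definition _ :=
  Monoid.isComLaw.Build C (RtoC 0) Cplus Cplus_assoc Cplus_comm Cplus_0_l.
HB.instance Definition _ :=
  Monoid.isComLaw.Build C (RtoC 1) Cmult Cmult_assoc Cmult_comm Cmult_1_l.
HB.instance Definition _ :=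
  Monoid.isMulLaw.Build C (RtoC 0) Cmult Cmult_0_l Cmult_0_r.
HB.instance Definition _ :=
  Monoid.isAddLaw.Build C Cmult Cplus Cmult_plus_distr_r Cmult_plus_distr_l.
HB.instance Definition _ :=
  Monoid.isComLaw.Build Z 1%Z Z.mul Z.mul_assoc Z.mul_comm Z.mul_1_l.

HB.instance Definition _ :=
  Monoid.isComLaw.Build Z 0%Z Z.add Z.add_assoc Z.add_comm Z.add_0_l.
HB.instance Definition _ :=
  Monoid.isMulLaw.Build Z 0%Z Z.mul Z.mul_0_l Z.mul_0_r.
HB.instance Definition _ :=
  Monoid.isAddLaw.Build Z Z.mul Z.add Z.mul_add_distr_r Z.mul_add_distr_l.

(** * Sums over multi-indices *)

Definition mterm (c : nat -> C) N (m : multi_index N) : C :=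
  (mmonomial m c / RtoC (INR (mfact m)))%C.

(** The weight phi sees m only through |m|, M_1 and M_2, like the numbers
a_m(p); several weights are compared below while c^m / m! stays the same. *)
Definition msum (c : nat -> C) (N : nat) (phi : nat -> nat -> nat -> Z) : C :=
  \big[Cplus/RtoC 0]_(m : multi_index N | mweight m == N)
    (RtoC (IZR (phi (msize m) (mweight m) (mweight2 m))) * mterm c m)%C.

(** Entries of a multi-index as a function on all naturals, so that multi-indices
with different index sets can be compared. *)
Definition mext N' (m : multi_index N') (j : nat) : nat :=
  oapp (fun j' : 'I_N' => m j' : nat) 0 (insub j).

Lemma mext_ord N' (m : multi_index N') (j : 'I_N') : mext m j = m j.
Proof. by rewrite /mext valK. Qed.

Lemma mext_out N' (m : multi_index N') (j : nat) : N' <= j -> mext m j = 0.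
Proof. by move=> h; rewrite /mext insubN // -leqNgt. Qed.

Lemma mext_le N' (m : multi_index N') (j : nat) : mext m j <= N'.
Proof. by rewrite /mext; case: insub => //= a; rewrite -ltnS. Qed.

Lemma big_mext T (idx : T) (op : Monoid.com_law idx) N' N (m : multi_index N')
    (F : nat -> nat -> T) : N' <= N -> (forall j, F j 0 = idx) ->
  \big[op/idx]_(j < N) F j (mext m j) = \big[op/idx]_(j < N') F j (m j).
Proof.
move=> hN hF.
rewrite -(big_mkord xpredT (fun j => F j (mext m j))) (big_cat_nat _ hN) //=.
rewrite [X in op _ X]big_nat [X in op _ X]big1 => [|j /andP[h _]].
  rewrite Monoid.mulm1 big_mkord; apply: eq_bigr => j _; by rewrite mext_ord.
by rewrite mext_out.
Qed.

(** [mup i] is m + e_i.  Its target has a larger index set, since adding e_i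
increases the weight and [multi_index] is indexed by the weight. *)
Definition mup N' N (i : 'I_N) (m : multi_index N') : multi_index N :=
  [ffun j : 'I_N => inord (mext m j + (j == i))].
Definition mdown N' N (i : 'I_N) (m : multi_index N) : multi_index N' :=
  [ffun j : 'I_N' => inord (mext m j - (j == i :> nat))].

Section Up.
Variables (N' N : nat) (i : 'I_N) (hN : N' < N) (m : multi_index N').

Lemma mupE (j : 'I_N) : mup i m j = mext m j + (j == i) :> nat.
Proof.
rewrite ffunE inordK // ltnS.
apply: leq_trans hN; rewrite -addn1; apply: leq_add; first exact: mext_le.
by case: (j == i).
Qed.

Lemma sum_mup (F : nat -> nat) :
  \sum_(j < N) F j * mup i m j = \sum_(j < N') F j * m j + F i.
Proof.
have -> : \sum_(j < N) F j * mup i m j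
        = \sum_(j < N) F j * mext m j + \sum_(j < N) (if j == i then F j else 0).
  rewrite -big_split /=; apply: eq_bigr => j _; rewrite mupE mulnDr.
  by case: (j == i); rewrite ?muln1 ?muln0.
rewrite (@big_mext _ _ _ N' N m (fun j x => F j * x)) ?(ltnW hN) //; last by move=> j;
  rewrite muln0.
by rewrite -big_mkcond /= big_pred1_eq.
Qed.

Lemma msize_mup : msize (mup i m) = (msize m).+1.
Proof.
have := sum_mup (fun=> 1); rewrite addn1 => H.
by rewrite /msize -(eq_bigr _ (fun j _ => mul1n _)) H; congr S; apply: eq_bigr => j _;
  rewrite mul1n.
Qed.
Lemma mweight_mup : mweight (mup i m) = mweight m + i.+1.
Proof. exact: (sum_mup (fun j => j.+1)). Qed.
Lemma mweight2_mup : mweight2 (mup i m) = mweight2 m + expn i.+1 2.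
Proof. exact: (sum_mup (fun j => expn j.+1 2)). Qed.

Lemma mfact_mup : mfact (mup i m) = (mup i m i) * mfact m.
Proof.
have -> : mfact (mup i m)
        = (\prod_(j < N) (mext m j)`!) * \prod_(j < N) (if j == i then (mext m j).+1 else 1).
  rewrite -big_split /=; apply: eq_bigr => j _; rewrite mupE.
  by case: (j == i); rewrite ?addn0 ?muln1 // addn1 factS mulnC.
rewrite (@big_mext _ _ _ N' N m (fun j x => x`!)) ?(ltnW hN) //.
by rewrite -big_mkcond /= big_pred1_eq mupE eqxx addn1 mulnC.
Qed.

Lemma mmonomial_mup c : mmonomial (mup i m) c = (c i.+1 * mmonomial m c)%C.
Proof.
have -> : mmonomial (mup i m) c
        = (\big[Cmult/RtoC 1]_(j < N) (c j.+1 ^ mext m j)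
           * \big[Cmult/RtoC 1]_(j < N) (if j == i then c j.+1 else RtoC 1))%C.
  rewrite -big_split /=; apply: eq_bigr => j _; rewrite mupE.
  case: (j == i); rewrite ?addn0 ?addn1 /=; ring.
rewrite (@big_mext _ _ _ N' N m (fun j x => (c j.+1 ^ x)%C)) ?(ltnW hN) //.
by rewrite -big_mkcond /= big_pred1_eq Cmult_comm.
Qed.

Lemma mupK : mdown N' i (mup i m) = m.
Proof.
apply/ffunP => j; apply: ord_inj.
have jN : j < N by apply: ltn_trans hN.
rewrite ffunE (_ : mext _ j = mup i m (Ordinal jN)); last by rewrite -mext_ord.
rewrite mupE /= (mext_ord m j) addnK inordK //.
Qed.
End Up.

Lemma mfact_neq0 N (m : multi_index N) : INR (mfact m) <> 0%R.
Proof.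
apply: not_0_INR => /eqP; apply/negP; rewrite -lt0n.
by apply: prodn_gt0 => j; apply: fact_gt0.
Qed.

(** An entry m_j with j at least N - (i+1), other than a single unit at j = i,
would together with m_i make the weight exceed N; hence the truncation in
[mdown] loses nothing. *)
Lemma mdownK N (i : 'I_N) (m : multi_index N) : mweight m = N -> 0 < m i ->
  mup i (mdown (N - i.+1) i m) = m.
Proof.
move=> hm mi.
have iN := ltn_ord i.
have hN : N - i.+1 < N by rewrite ltn_subrL (leq_ltn_trans _ iN).
have le1 (j : 'I_N) : j.+1 * m j <= N.
  apply: (@leq_trans (mweight m)); last by rewrite hm.
  by rewrite /mweight (bigD1 j) //= leq_addr.
have le2 (j : 'I_N) : j != i -> j.+1 * m j + i.+1 * m i <= N.
  move=> ji; apply: (@leq_trans (mweight m)); last by rewrite hm.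
  by rewrite /mweight (bigD1 j) //= (bigD1 i) ?(eq_sym i) //= addnA leq_addr.
apply/ffunP => j; apply: ord_inj; rewrite (mupE i hN).
have eji : (j == i) = (j == i :> nat) by [].
case: (ltnP j (N - i.+1)) => hj.
  have -> : mext (mdown (N - i.+1) i m) j = mdown (N - i.+1) i m (Ordinal hj).
    by rewrite -mext_ord.
  rewrite ffunE /= (mext_ord m j) eji inordK; last first.
    have := le1 j; have := le2 j; rewrite eji; case: eqP => [e _|_ /(_ isT)]; nia.
  case: eqP => e /=; last by rewrite subn0 addn0.
  by rewrite (_ : j = i) ?subnK //; apply: ord_inj.
rewrite mext_out // add0n eji.
have h1 := le1 j; have h2 := le2 j; have hj' : N <= j + i.+1 by lia.
move: h2; rewrite eji; case: eqP => [e _|_ /(_ isT)] /=.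
  rewrite (_ : j = i) in h1 hj' *; last exact: ord_inj.
  case: (m i : nat) mi h1 => [//|[//|x]] _; rewrite !mulnS; lia.
by case: (m j : nat) => [//|x]; case: (m i : nat) mi => [//|y] _; rewrite !mulnS; lia.
Qed.

(** The bijection m -> m + e_i multiplies c^m / m! by c_i / (m_i + 1). *)
Lemma msum_shift c N (i : 'I_N) (phi : nat -> nat -> nat -> Z) :
  (c i.+1 * msum c (N - i.+1) phi)%C =
  \big[Cplus/RtoC 0]_(m : multi_index N | mweight m == N)
    (RtoC (IZR (Z.of_nat (m i) *
        phi (msize m).-1 (mweight m - i.+1)%nat (mweight2 m - expn i.+1 2)%nat))
      * mterm c m)%C.
Proof.
have iN := ltn_ord i.
have hN : N - i.+1 < N by lia.
rewrite (bigID (fun m : multi_index N => 0 < m i)) /= [X in (_ = _ + X)%C]big1; last first.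
  by move=> m /andP[_ h]; rewrite (_ : m i = 0 :> nat) ?Cmult_0_l //; lia.
rewrite Cplus_0_r (reindex_onto (mup i) (mdown (N - i.+1) i)) /=; last first.
  by move=> m /andP[/eqP h1 h2]; apply: mdownK.
rewrite /msum big_distrr /=; apply: eq_big => [m|m _].
  rewrite (mupK i hN) eqxx andbT (mweight_mup i hN) (mupE i hN) eqxx /= addn1 /= andbT.
  apply/eqP/eqP; lia.
rewrite (msize_mup i hN) (mweight_mup i hN) (mweight2_mup i hN) !addnK /=.
rewrite /mterm (mfact_mup i hN) (mmonomial_mup i hN) mult_IZR -INR_IZR_INZ mult_INR.
rewrite !RtoC_mult /Cdiv.
have h1 : RtoC (INR (mup i m i)) <> RtoC 0.
  by rewrite (mupE i hN) eqxx => /RtoC_inj; apply: not_0_INR; lia.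
have h2 : RtoC (INR (mfact m)) <> RtoC 0 by move=> /RtoC_inj; apply: mfact_neq0.
move: (RtoC (INR (mup i m i))) (RtoC (INR (mfact m))) h1 h2 => x y hx hy.
by move: (RtoC (IZR _)) => u; field.
Qed.


(** Generating series of psi-sums = (1 + sum_i d_i c_i t^i) times generating
series of phi-sums: the factor c_i consumes one unit of the entry m_i, and by
[msum_shift] this happens with multiplicity m_i. *)
Lemma msum_conv c N (d : nat -> Z) (phi psi : nat -> nat -> nat -> Z) :
  (forall m : multi_index N, mweight m = N -> psi (msize m) (mweight m) (mweight2 m) =
     (phi (msize m) (mweight m) (mweight2 m) +
      \big[Z.add/0%Z]_(i < N) (d i.+1 * (Z.of_nat (m i) *
        phi (msize m).-1 (mweight m - i.+1)%nat (mweight2 m - expn i.+1 2)%nat)))%Z) ->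
  msum c N psi =
  (msum c N phi + \big[Cplus/RtoC 0]_(i < N)
                   (RtoC (IZR (d i.+1)) * c i.+1 * msum c (N - i.+1) phi))%C.
Proof.
move=> h.
under [X in (_ = _ + X)%C]eq_bigr => i _.
  rewrite -Cmult_assoc msum_shift big_distrr /=; over.
rewrite exchange_big /= /msum -big_split /=; apply: eq_bigr => m /eqP hm.
rewrite h // plus_IZR RtoC_plus Cmult_plus_distr_r; congr Cplus.
rewrite (big_morph IZR plus_IZR (erefl _)) (big_morph RtoC RtoC_plus (erefl _)) big_distrl /=.
by apply: eq_bigr => i _; rewrite !mult_IZR !RtoC_mult !Cmult_assoc.
Qed.

Lemma sum_entries N (m : multi_index N) (a b e : Z) (F : 'I_N -> Z) :
  (forall i : 'I_N, 0 < m i -> F i = (a + b * Z.of_nat i.+1 + e * Z.of_nat (expn i.+1 2))%Z) ->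
  \big[Z.add/0%Z]_(i < N) (Z.of_nat (m i) * F i)%Z
  = (a * Z.of_nat (msize m) + b * Z.of_nat (mweight m) + e * Z.of_nat (mweight2 m))%Z.
Proof.
move=> h; have ZD : {morph Z.of_nat : x y / addn x y >-> Z.add x y} by move=> x y; lia.
rewrite /msize /mweight /mweight2 !(big_morph Z.of_nat ZD (erefl _)) !big_distrr -!big_split /=.
apply: eq_bigr => i _; case: (posnP (m i)) => [->|/h ->]; first by rewrite !muln0; lia.
move: (expn _ _) => u; lia.
Qed.

Lemma entry_bounds N (m : multi_index N) (i : 'I_N) : 0 < m i ->
  [/\ 0 < msize m, i.+1 <= mweight m & expn i.+1 2 <= mweight2 m].
Proof.
move=> h; split; rewrite ?/msize ?/mweight ?/mweight2 (bigD1 i) //=.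
- by rewrite (leq_trans h) // leq_addr.
- by rewrite (leq_trans (leq_pmulr _ h)) // leq_addr.
- by rewrite (leq_trans (leq_pmulr _ h)) // leq_addr.
Qed.

(** * The numbers a_m(p) and their recursion in p *)

Section AcoefRecursion.
Local Arguments Z.mul : simpl never.
Local Arguments Z.add : simpl never.
Local Arguments Z.sub : simpl never.
Local Arguments Z.pow : simpl never.
Local Arguments Z.of_nat : simpl never.

Definition acoef_of (p : Z) (n M1 M2 : nat) : Z :=
  let M1 := Z.of_nat M1 in
  let M2 := Z.of_nat M2 in
  match n with
  | 0%nat => 1
  | 1%nat => 2 * M1 - p
  | n => (-1) ^ Z.of_nat n
         * (\big[Z.mul/1%Z]_(2 <= i < n) (p + Z.of_nat i)%Z)
         * (p * (p + 1) + M1 ^ 2 - 2 * (p + 1) * M1 - M2)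
  end%Z.

Lemma acoef_sumE c N p : acoef_sum c N p = msum c N (acoef_of p).
Proof. by apply: eq_bigr => m _; rewrite /acoef /acoef_of; case: (msize m) => [|[]]. Qed.

(** When m_i > 0 the summand is a_(m - e_i)(p), whose dependence on i is
quadratic in i+1.  Weighting by m_i and summing therefore leaves an expression
in |m|, M_1 and M_2 alone, and for |m| > 2 the factor (p+1) needed on the left
appears after collecting terms. *)
Lemma acoef_of_pred p N (m : multi_index N) :
  acoef_of (p - 1) (msize m) (mweight m) (mweight2 m) =
  (acoef_of p (msize m) (mweight m) (mweight2 m) +
   \big[Z.add/0%Z]_(i < N) (1 * (Z.of_nat (m i) *
     acoef_of p (msize m).-1 (mweight m - i.+1)%nat (mweight2 m - expn i.+1 2)%nat)))%Z.
Proof.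
have hb := @entry_bounds N m.
under [X in (_ = _ + X)%Z]eq_bigr => i _ do rewrite Z.mul_1_l.
case en : (msize m) => [|[|[|n]]] /=.
- rewrite big1 // => i _; case: (posnP (m i)) => [->|/hb[]] //; lia.
- rewrite (sum_entries (a := 1) (b := 0) (e := 0)) ?en //=; lia.
- rewrite (sum_entries (a := 2 * Z.of_nat (mweight m) - p) (b := - 2) (e := 0)) ?en //=.
    rewrite !big_geq //; lia.
  by move=> i /hb[]; lia.
set M1 := Z.of_nat (mweight m); set M2 := Z.of_nat (mweight2 m).
have e1 : \big[Z.mul/1%Z]_(2 <= i < n.+3) (p + Z.of_nat i)%Z
   = (\big[Z.mul/1%Z]_(2 <= i < n.+2) (p + Z.of_nat i) * (p + Z.of_nat n.+2))%Z.
  by rewrite big_nat_recr.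
have e2 : \big[Z.mul/1%Z]_(2 <= i < n.+3) (p - 1 + Z.of_nat i)%Z
   = ((p + 1) * \big[Z.mul/1%Z]_(2 <= i < n.+2) (p + Z.of_nat i))%Z.
  rewrite big_nat_recl //; congr Z.mul; first lia.
  by apply: eq_bigr => i _; lia.
have e3 : ((-1) ^ Z.of_nat n.+3 = - (-1) ^ Z.of_nat n.+2)%Z.
  by rewrite (Nat2Z.inj_succ n.+2) Z.pow_succ_r; lia.
rewrite e1 e2 e3.
set P := \big[Z.mul/1%Z]_(_ <= _ < _) _; set s := ((-1) ^ _)%Z.
rewrite (sum_entries (a := s * P * (p * (p + 1) + M1 ^ 2 - 2 * (p + 1) * M1 - M2))
  (b := s * P * (2 * (p + 1) - 2 * M1)) (e := s * P * 2)) ?en; last first.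
  move=> i /hb[_ h1 h2].
  have -> : Z.of_nat (mweight m - i.+1) = (M1 - Z.of_nat i.+1)%Z by lia.
  have -> : Z.of_nat (mweight2 m - expn i.+1 2) = (M2 - Z.of_nat i.+1 ^ 2)%Z by lia.
  have -> : Z.of_nat (expn i.+1 2) = (Z.of_nat i.+1 ^ 2)%Z by lia.
  ring.
have -> : Z.of_nat n.+3 = (Z.of_nat n.+2 + 1)%Z by lia.
rewrite -/M1 -/M2; ring.
Qed.

(** The coefficients of f(t)/t. *)
Definition ucoef (c : nat -> C) (i : nat) : C := if i is 0 then RtoC 1 else c i.

(** On generating series in t, this is multiplication by f(t)/t. *)
Lemma acoef_sum_pred c N p :
  acoef_sum c N (p - 1) =
  (\big[Cplus/RtoC 0]_(i < N.+1) (ucoef c i * acoef_sum c (N - i) p))%C.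
Proof.
rewrite !acoef_sumE (@msum_conv c N (fun=> 1%Z) (acoef_of p)).
  rewrite big_ord_recl /= subn0 Cmult_1_l; congr Cplus; first by rewrite acoef_sumE.
  by apply: eq_bigr => i _; rewrite /= Cmult_1_l acoef_sumE.
by move=> m _; exact: acoef_of_pred.
Qed.

Lemma msum_unit c N :
  msum c N (fun n _ _ => if n is 0 then 1%Z else 0%Z) = if N is 0 then RtoC 1 else RtoC 0.
Proof.
rewrite /msum; case: N => [|N].
  rewrite (big_pred1 [ffun=> ord0]) => [|m].
    rewrite /msize big_ord0 /mterm /mmonomial /mfact !big_ord0 /=; field.
  have -> : m = [ffun=> ord0] by apply/ffunP => -[].
  by rewrite /= eqxx /mweight big_ord0.
apply: big1 => m /eqP hm; case e: (msize m) => [|n]; last by rewrite Cmult_0_l.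
have : mweight m = 0; last by rewrite hm.
rewrite /mweight big1 // => i _; case: (posnP (m i)) => [->|/entry_bounds[]];
  first exact: muln0.
by rewrite e.
Qed.

(** The weight whose sums are the coefficients of f': only |m| < 2
contributes, since f' is linear in the c_i. *)
Definition deriv_weight (n M1 M2 : nat) : Z :=
  match n with 0%nat => 1 | 1%nat => Z.of_nat M1 + 1 | _ => 0 end%Z.

Lemma msum_deriv_weight c N : msum c N deriv_weight = (RtoC (INR N.+1) * ucoef c N)%C.
Proof.
rewrite (@msum_conv c N (fun i => Z.of_nat i + 1)%Z (fun n _ _ => if n is 0 then 1%Z else 0%Z)).
  under eq_bigr => i _ do rewrite msum_unit.
  rewrite msum_unit; case: N => [|N]; first by rewrite big_ord0 /=; ring.
  rewrite (S_INR N.+1) big_ord_recr /= subnn big1 => [|i _].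
    rewrite plus_IZR -INR_IZR_INZ !RtoC_plus; ring.
  by rewrite subSS (_ : N - i = (N - i.+1).+1) ?Cmult_0_r //; have := ltn_ord i; lia.
move=> m _; have hb := @entry_bounds N m.
case en : (msize m) => [|[|n]] /=.
- rewrite big1 // => i _; case: (posnP (m i)) => [->|/hb[]] //; lia.
- under eq_bigr => i _ do rewrite Z.mul_1_r Z.mul_comm.
  rewrite (sum_entries (a := 1) (b := 1) (e := 0)) ?en //=; lia.
- by rewrite big1 // => i _; lia.
Qed.

(** A(-2) = f'^2 for generating series: f' is the series of [deriv_weight], and
multiplying once more by f' gives exactly the weights a_m(-2), which vanish for
|m| > 2. *)
Lemma acoef_sum_m2 c N :
  acoef_sum c N (-2) = (\big[Cplus/RtoC 0]_(i < N.+1) (RtoC (INR i.+1) * ucoef c i *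
   (RtoC (INR (N - i).+1) * ucoef c (N - i))))%C.
Proof.
rewrite acoef_sumE (@msum_conv c N (fun i => Z.of_nat i + 1)%Z deriv_weight).
  rewrite big_ord_recl /= subn0 msum_deriv_weight Cmult_1_l Cmult_1_l; congr Cplus.
  by apply: eq_bigr => i _; rewrite msum_deriv_weight plus_IZR -INR_IZR_INZ -S_INR.
move=> m _; have hb := @entry_bounds N m.
case en : (msize m) => [|[|[|n]]] /=.
- rewrite big1 // => i _; case: (posnP (m i)) => [->|/hb[]] //; lia.
- under eq_bigr => i _ do rewrite Z.mul_1_r Z.mul_comm.
  rewrite (sum_entries (a := 1) (b := 1) (e := 0)) ?en //=; lia.
- under [X in (_ = _ + X)%Z]eq_bigr =>
  i _ do rewrite Z.mul_assoc [X in Z.mul X _]Z.mul_comm -Z.mul_assoc.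
  rewrite (sum_entries (a := Z.of_nat (mweight m) + 1) (b := Z.of_nat (mweight m))
     (e := - 1)) ?en //=; first by rewrite big_geq //; lia.
  move=> i /hb[_ h1 _].
  have -> : Z.of_nat (mweight m - i.+1) = (Z.of_nat (mweight m) - Z.of_nat i.+1)%Z by lia.
  have -> : Z.of_nat (expn i.+1 2) = (Z.of_nat i.+1 ^ 2)%Z by lia.
  ring.
rewrite [X in (_ = _ + X)%Z]big1 => [|i _]; last lia.
rewrite big_ltn // (_ : (-2 + Z.of_nat 2 = 0)%Z) //; ring.
Qed.

End AcoefRecursion.

Local Open Scope R_scope.

(** * Complex power series on the unit disc *)

Notation is_Cseries := (is_series (K := C_AbsRing) (V := C_NormedModule)).

Lemma Cseries_lim (u : nat -> C) (l : C) :
  is_Cseries u l <-> is_lim_seq (fun n => Cmod (sum_n (G := C_AbelianMonoid) u n - l)%C) 0.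
Proof.
split=> h.
- apply/is_lim_seq_spec => eps.
  have := proj1 (filterlim_locally_ball_norm (K := C_AbsRing) (U := C_NormedModule) _ _) h eps.
  case=> n0 hn; exists n0 => n hn'; have := hn n hn'.
  by rewrite Rminus_0_r Rabs_pos_eq //; apply: Cmod_ge_0.
- apply/(filterlim_locally_ball_norm (K := C_AbsRing) (U := C_NormedModule)) => eps.
  move/is_lim_seq_spec: h => /(_ eps) [n0 hn]; exists n0 => n hn'; have := hn n hn'.
  by rewrite Rminus_0_r Rabs_pos_eq //; apply: Cmod_ge_0.
Qed.

Lemma Cseries_unique (u : nat -> C) (l1 l2 : C) : is_Cseries u l1 -> is_Cseries u l2 -> l1 = l2.
Proof. by move=> h1 h2; apply: (filterlim_locally_unique _ _ _ h1 h2). Qed.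

Lemma Cmod_sum_n (u : nat -> C) (v : nat -> R) n : (forall n, Cmod (u n) <= v n) ->
  Cmod (sum_n (G := C_AbelianMonoid) u n) <= sum_n v n.
Proof.
move=> h; elim: n => [|n IH]; first by rewrite !sum_O.
rewrite !sum_Sn; apply: Rle_trans (Cmod_triangle _ _) _.
by apply: Rplus_le_compat.
Qed.

Lemma Cmod_le_sub (l s : C) : Cmod l <= Cmod s + Cmod (s - l)%C.
Proof.
have e : l = (s + - (s - l))%C by ring.
by rewrite {1}e; apply: Rle_trans (Cmod_triangle _ _) _; rewrite Cmod_opp; right.
Qed.

Lemma Cseries_bound (u : nat -> C) (v : nat -> R) l s : (forall n, Cmod (u n) <= v n) ->
  is_Cseries u l -> is_series v s -> Cmod l <= s.
Proof.
move=> h /Cseries_lim hu hv.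
have := is_lim_seq_plus' _ _ _ _ hv hu; rewrite Rplus_0_r => hs.
apply: (is_lim_seq_le _ _ (Cmod l) s _ (is_lim_seq_const _) hs) => n.
apply: Rle_trans (Cmod_le_sub l (sum_n (G := C_AbelianMonoid) u n)) _.
by apply: Rplus_le_compat_r; apply: Cmod_sum_n.
Qed.

(** Cauchy's estimates.  For coefficient sequences they amount to convergence
on the open unit disc, and they are easily seen to survive the operations on
coefficients used below. *)
Definition tame (a : nat -> C) : Prop :=
  forall rho, 0 < rho < 1 -> exists M, forall n, Cmod (a n) * rho ^ n <= M.

Definition psum (a : nat -> C) (t : C) : C :=
  iota (T := C_CompleteNormedModule) (fun l => is_Cseries (fun n => a n * t ^ n)%C l).

Lemma geom_dominated (a : nat -> C) (t : C) rho M : 0 < rho -> Cmod t < rho ->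
  (forall n, Cmod (a n) * rho ^ n <= M) ->
  (forall n, Cmod (a n * t ^ n) <= M * (Cmod t / rho) ^ n) /\
  is_series (fun n => M * (Cmod t / rho) ^ n) (M * / (1 - Cmod t / rho)).
Proof.
move=> hr ht ha; have h0 := Cmod_ge_0 t; split=> [n|].
  rewrite Cmod_mult Cmod_pow.
  have -> : Cmod (a n) * Cmod t ^ n = Cmod (a n) * rho ^ n * (Cmod t / rho) ^ n.
    rewrite Rmult_assoc -Rpow_mult_distr; congr (_ * _ ^ _); field; lra.
  apply: Rmult_le_compat_r (ha n).
  by apply: pow_le; apply: Rdiv_le_0_compat.
apply: (is_series_scal_l (K := R_AbsRing)); apply: is_series_geom.
rewrite Rabs_pos_eq; last exact: Rdiv_le_0_compat.
by apply/Rlt_div_l; lra.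
Qed.

Lemma tame_mid a t : tame a -> Cmod t < 1 -> exists rho M, 0 < rho < 1 /\ Cmod t < rho /\
  forall n, Cmod (a n) * rho ^ n <= M.
Proof.
move=> ha ht; have h0 := Cmod_ge_0 t.
have h : 0 < (1 + Cmod t) / 2 < 1 by lra.
by case: (ha _ h) => M hM; exists ((1 + Cmod t) / 2), M; do !split => //; lra.
Qed.

Lemma psumP a t : tame a -> Cmod t < 1 -> is_Cseries (fun n => a n * t ^ n)%C (psum a t).
Proof.
move=> ha ht; case: (tame_mid ha ht) => rho [M [h1 [h2 h3]]].
case: (geom_dominated (proj1 h1) h2 h3) => h4 h5.
have [l hl] : ex_series (K := C_AbsRing) (V := C_CompleteNormedModule) (fun n => a n * t ^ n)%C.
  apply: (ex_series_le (V := C_CompleteNormedModule) _ (fun n => M * (Cmod t / rho) ^ n));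
    first exact: h4.
  by exists (M * / (1 - Cmod t / rho)).
apply: (iota_correct (V := C_CompleteNormedModule)).
by exists l; split=> // l'; apply: Cseries_unique.
Qed.

Lemma psum_unique a t l : is_Cseries (fun n => a n * t ^ n)%C l -> psum a t = l.
Proof.
move=> h; apply: (Cseries_unique _ h).
apply: (iota_correct (V := C_CompleteNormedModule)).
by exists l; split=> // l'; apply: Cseries_unique.
Qed.

Lemma psum_bound a t rho M : 0 < rho < 1 -> Cmod t < rho ->
  (forall n, Cmod (a n) * rho ^ n <= M) ->
  tame a -> Cmod (psum a t) <= M * / (1 - Cmod t / rho).
Proof.
move=> h1 h2 h3 ha; case: (geom_dominated (proj1 h1) h2 h3) => h4 h5.
by apply: (Cseries_bound h4 _ h5); apply: psumP => //; lra.
Qed.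

Lemma tame_of_series (a : nat -> C) (F : C -> C) :
  (forall t, Cmod t < 1 -> is_Cseries (fun n => a n * t ^ n)%C (F t)) -> tame a.
Proof.
move=> h rho hr.
have hc : Cmod (RtoC rho) = rho by rewrite Cmod_R Rabs_pos_eq; lra.
have hs := h (RtoC rho); rewrite hc in hs; move: (hs (proj2 hr)) => {}hs.
have : is_lim_seq (fun n => Cmod (a n.+1 * rho ^ n.+1)%C) 0.
  move/Cseries_lim: hs => hs.
  have hs1 := proj1 (is_lim_seq_incr_1 _ _) hs.
  have := is_lim_seq_plus' _ _ _ _ hs hs1; rewrite Rplus_0_r.
  apply: (is_lim_seq_le_le (fun _ => 0)) (is_lim_seq_const _) => n.
  split; first exact: Cmod_ge_0.
  rewrite sum_Sn; set s := sum_n _ _; set u := (a _ * _)%C.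
  have e : u = ((Hierarchy.plus s u : C) - F rho + - (s - F rho))%C.
    by rewrite /Hierarchy.plus /=; move: (s : C) (F _) (u : C) => x y z; ring.
  by rewrite {1}e; apply: Rle_trans (Cmod_triangle _ _) _; rewrite Cmod_opp Rplus_comm; right.
move=> /(proj2 (is_lim_seq_incr_1 (fun n => Cmod (a n * rho ^ n)%C) 0)) hl.
have [M hM] := filterlim_bounded (K := R_AbsRing) (V := R_NormedModule)
  (fun n => Cmod (a n * rho ^ n)%C) (ex_intro _ 0 hl).
exists M => n; apply: Rle_trans (hM n).
rewrite /norm /= /abs /= Rabs_pos_eq; last exact: Cmod_ge_0.
by rewrite Cmod_mult Cmod_pow hc; right.
Qed.

Lemma tame_le (a : nat -> C) : (forall rho0, 0 < rho0 < 1 -> exists rho, rho0 <= rho < 1 /\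
    exists M, forall n, Cmod (a n) * rho ^ n <= M) -> tame a.
Proof.
move=> h rho0 h0; case: (h _ h0) => rho [h1 [M hM]]; exists M => n.
apply: Rle_trans (hM n); apply: Rmult_le_compat_l; first exact: Cmod_ge_0.
by apply: pow_incr; lra.
Qed.

Definition shift (j : nat) (a : nat -> C) (n : nat) : C := a (j + n)%nat.

Lemma shift_bound a rho M j : 0 < rho -> (forall n, Cmod (a n) * rho ^ n <= M) ->
  forall n, Cmod (shift j a n) * rho ^ n <= M * / rho ^ j.
Proof.
move=> hr h n; have hj : 0 < rho ^ j by apply: pow_lt.
apply/(Rle_div_r _ _ _ hj); rewrite /shift; apply: Rle_trans (h (j + n)%nat).
have -> : rho ^ (j + n)%nat = rho ^ j * rho ^ n by exact: pow_add.
right; ring.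
Qed.

Lemma tame_shift j a : tame a -> tame (shift j a).
Proof. by move=> h rho hr; case: (h _ hr) => M hM; exists (M * / rho ^ j);
  apply: shift_bound => //; lra. Qed.

(** The tails B_j = sum_n a_(j+n) z^n satisfy B_j = a_j + z B_(j+1); they are the
coefficients of the synthetic division by t - z. *)
Definition tails (a : nat -> C) (z : C) (j : nat) : C := psum (shift j a) z.

(** Cauchy's estimate with a radius rho > |z| bounds the shifted series at z by
a constant times rho^(-j). *)
Lemma tame_tails a z : tame a -> Cmod z < 1 -> tame (tails a z).
Proof.
move=> ha hz; apply: tame_le => rho0 hr0; have h0 := Cmod_ge_0 z.
set rho := (1 + Rmax rho0 (Cmod z)) / 2.
have hm := Rmax_l rho0 (Cmod z); have hm' := Rmax_r rho0 (Cmod z).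
have hm1 : Rmax rho0 (Cmod z) < 1 by apply: Rmax_lub_lt; lra.
have hr : 0 < rho < 1 by rewrite /rho; lra.
have hzr : Cmod z < rho by rewrite /rho; lra.
exists rho; split; first by rewrite /rho; lra.
case: (ha _ hr) => M hM; exists (M * / (1 - Cmod z / rho)) => n.
have hn : 0 < rho ^ n by apply: pow_lt; lra.
have := psum_bound hr hzr (shift_bound n (proj1 hr) hM) (tame_shift n ha).
move/(Rmult_le_compat_r (rho ^ n) _ _ (Rlt_le _ _ hn)) => h.
apply: Rle_trans h _; right; field; split; try lra.
Qed.

Lemma psum_rec a z : tame a -> Cmod z < 1 -> psum a z = (a 0%nat + z * psum (shift 1 a) z)%C.
Proof.
move=> ha hz; apply: psum_unique; apply: is_series_decr_1.
rewrite [X in is_series _ X](_ : _ = z * psum (shift 1 a) z)%C; last first.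
  by rewrite /plus /opp /=; move: (psum _ _) (a _) => x y; ring.
apply: (is_series_ext (fun n => scal z (shift 1 a n * z ^ n)%C)).
  by move=> n; rewrite /scal /= /mult /= /shift /= add1n; ring.
by apply: is_series_scal_l; apply: psumP => //; apply: tame_shift.
Qed.

Lemma psum_ext a b t : (forall n, a n = b n) -> tame a -> Cmod t < 1 -> psum a t = psum b t.
Proof.
move=> h ha ht; apply/esym/psum_unique; apply: is_series_ext (psumP ha ht) => n.
by rewrite h.
Qed.

Lemma tails_rec a z j : tame a -> Cmod z < 1 -> tails a z j = (a j + z * tails a z j.+1)%C.
Proof.
move=> ha hz; have hj := tame_shift j ha.
rewrite {1}/tails psum_rec // {1}/shift addn0; congr (_ + _ * _)%C.
apply: psum_ext => // [n|]; last exact: tame_shift.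
by rewrite /shift addnA addn1.
Qed.

Lemma tame_plus a b : tame a -> tame b -> tame (fun n => a n + b n)%C.
Proof.
move=> ha hb rho hr; case: (ha _ hr) => M hM; case: (hb _ hr) => M' hM'.
exists (M + M') => n; apply: Rle_trans (Rplus_le_compat _ _ _ _ (hM n) (hM' n)).
rewrite -Rmult_plus_distr_r; apply: Rmult_le_compat_r (Cmod_triangle _ _).
by apply: pow_le; lra.
Qed.

Lemma tame_scal l a : tame a -> tame (fun n => l * a n)%C.
Proof.
move=> ha rho hr; case: (ha _ hr) => M hM.
exists (Cmod l * M) => n; rewrite Cmod_mult Rmult_assoc.
by apply: Rmult_le_compat_l (hM n); exact: Cmod_ge_0.
Qed.

Lemma psum_plus a b t : tame a -> tame b -> Cmod t < 1 ->
  psum (fun n => a n + b n)%C t = (psum a t + psum b t)%C.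
Proof.
move=> ha hb ht; apply: psum_unique.
apply: is_series_ext (is_series_plus _ _ _ _ (psumP ha ht) (psumP hb ht)) => n.
rewrite /plus /=; ring.
Qed.

Lemma psum_scal l a t : tame a -> Cmod t < 1 -> psum (fun n => l * a n)%C t = (l * psum a t)%C.
Proof.
move=> ha ht; apply: psum_unique.
apply: is_series_ext (is_series_scal_l l _ _ (psumP ha ht)) => n.
rewrite /scal /= /mult /=; ring.
Qed.

(** Coefficients of (F(t) - F(z)) / (t - z), where F is the sum of [a]. *)
Definition quot (a : nat -> C) (z : C) (j : nat) : C := tails a z j.+1.

Lemma tame_quot a z : tame a -> Cmod z < 1 -> tame (quot a z).
Proof. by move=> ha hz; apply: (tame_shift 1); apply: tame_tails. Qed.

(** Both sides express the sum of B_j t^j, once by splitting off B_0 = F(z) and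
once by substituting B_j = a_j + z B_(j+1). *)
Lemma psum_quot a z t : tame a -> Cmod z < 1 -> Cmod t < 1 ->
  psum a t = (psum a z + (t - z) * psum (quot a z) t)%C.
Proof.
move=> ha hz ht; have hT := tame_tails ha hz; have hQ := tame_quot ha hz.
have e1 : psum (tails a z) t = (psum a z + t * psum (quot a z) t)%C.
  by rewrite psum_rec //; congr (_ + _ * _)%C; apply: psum_ext => //; apply: tame_shift.
have e2 : psum (tails a z) t = (psum a t + z * psum (quot a z) t)%C.
  rewrite -psum_scal // -psum_plus //; last exact: tame_scal.
  by apply: psum_ext => // n; rewrite tails_rec.
have -> : psum a t = (psum (tails a z) t - z * psum (quot a z) t)%C by rewrite e2; ring.
rewrite e1; ring.
Qed.

Definition deriv (a : nat -> C) (n : nat) : C := (INR n.+1 * a n.+1)%C.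

(** (n+1) x^n is at most 1 + x + ... + x^n. *)
Lemma lin_geom x n : 0 <= x < 1 -> INR n.+1 * x ^ n * (1 - x) <= 1 - x ^ n.+1.
Proof.
move=> hx; elim: n => [|n IH]; first by rewrite /=; lra.
have h1 : 0 <= x ^ n.+1 by apply: pow_le; lra.
have h2 : x ^ n.+1 <= 1 by rewrite -(pow1 n.+1); apply: pow_incr; lra.
have h3 := Rmult_le_compat_l x _ _ (proj1 hx) IH.
have h4 : 0 <= (1 - x) * (1 - x ^ n.+1) by apply: Rmult_le_pos; lra.
have e1 : x ^ n.+1 = x * x ^ n by [].
have e2 : x ^ n.+2 = x * (x * x ^ n) by [].
rewrite (S_INR n.+1) e2 e1; rewrite e1 in h3 h4; move: (INR _) (x ^ n) h3 h4 => y p h3 h4; lra.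
Qed.

Lemma tame_deriv a : tame a -> tame (deriv a).
Proof.
move=> ha rho hr; set s := (1 + rho) / 2; have hs : 0 < s < 1 by rewrite /s; lra.
have hrs : rho < s by rewrite /s; lra.
case: (ha _ hs) => M hM; exists (M * / s * / (1 - rho / s)) => n.
have hx : 0 <= rho / s < 1.
  split; first by apply: Rdiv_le_0_compat; lra.
  by apply/Rlt_div_l; lra.
have M0 : 0 <= M.
  apply: Rle_trans (hM 0%nat); apply: Rmult_le_pos; first exact: Cmod_ge_0.
  by rewrite /=; lra.
have h := lin_geom n hx.
have hp : 0 <= (rho / s) ^ n.+1 by apply: pow_le; lra.
have h' : INR n.+1 * (rho / s) ^ n <= / (1 - rho / s).
  apply: (Rmult_le_reg_r (1 - rho / s)); first lra.
  by rewrite Rinv_l; lra.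
rewrite /deriv Cmod_mult Cmod_R Rabs_pos_eq; last exact: pos_INR.
have -> : INR n.+1 * Cmod (a n.+1) * rho ^ n
        = (Cmod (a n.+1) * s ^ n.+1) * / s * (INR n.+1 * (rho / s) ^ n).
  rewrite /Rdiv Rpow_mult_distr pow_inv; move: (INR _) => u /=; field.
  split; last lra; apply: pow_nonzero; lra.
apply: Rmult_le_compat => //.
- apply: Rmult_le_pos; last by apply/Rlt_le/Rinv_0_lt_compat; lra.
  by apply: Rmult_le_pos; [exact: Cmod_ge_0 | apply: pow_le; lra].
- by apply: Rmult_le_pos; [exact: pos_INR | apply: pow_le; lra].
- apply: Rmult_le_compat_r (hM _).
  by apply/Rlt_le/Rinv_0_lt_compat; lra.
Qed.

(** The value at z of the difference quotient is the derivative.  Multiplying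
B_(j+1) = a_(j+1) + z B_(j+2) by (j+1) z^j and summing over j telescopes to this
identity. *)
Lemma psum_deriv a z : tame a -> Cmod z < 1 -> psum (quot a z) z = psum (deriv a) z.
Proof.
move=> ha hz; have hT := tame_tails ha hz; have hQ := tame_quot ha hz.
pose V := deriv (tails a z); have hV : tame V by apply: tame_deriv.
pose W n := (V n + (- 1) * quot a z n)%C.
have hW : tame W by apply: tame_plus => //; apply: tame_scal.
have e1 : psum W z = (psum V z - psum (quot a z) z)%C.
  rewrite psum_plus ?psum_scal //; [ring | exact: tame_scal].
have e2 : psum W z = (z * psum (shift 1 W) z)%C.
  by rewrite psum_rec // {1}/W /V /deriv /quot /=; ring.
have e3 : psum V z = (psum (deriv a) z + z * psum (shift 1 W) z)%C.
  rewrite -psum_scal; [|exact: tame_shift| by []].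
  rewrite -psum_plus //; [|exact: tame_deriv|by apply/tame_scal/tame_shift].
  apply: psum_ext => // n; rewrite /V /W /shift /deriv /quot add1n tails_rec //.
  by rewrite /V /deriv (S_INR n.+1) RtoC_plus; ring.
have -> : psum (quot a z) z = (psum V z - psum W z)%C by rewrite e1; ring.
rewrite e3 e2; ring.
Qed.




(** * Continuity and complex differentiability *)

Definition cont (T : UniformSpace) (G : T -> C) (x : T) : Prop :=
  continuous (fun t => fst (G t)) x /\ continuous (fun t => snd (G t)) x.

Section Cont.
Variables (T : UniformSpace) (x : T).
Implicit Types G H : T -> C.

Lemma cont_const (a : C) : cont (fun _ : T => a) x.
Proof. by split; apply: continuous_const. Qed.

Lemma cont_plus G H : cont G x -> cont H x -> cont (fun t => G t + H t)%C x.
Proof. by move=> [g1 g2] [h1 h2]; split; apply: continuous_plus. Qed.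

Lemma cont_mult G H : cont G x -> cont H x -> cont (fun t => G t * H t)%C x.
Proof.
move=> [g1 g2] [h1 h2]; split => /=.
  by apply: continuous_minus; apply: continuous_mult.
by apply: continuous_plus; apply: continuous_mult.
Qed.

Lemma Csq_neq0 (w : C) : w <> RtoC 0 -> fst w ^ 2 + snd w ^ 2 <> 0.
Proof.
case: w => a b h /= e; apply: h; congr pair.
  by have := pow2_ge_0 b; have := pow2_ge_0 a; nra.
by have := pow2_ge_0 b; have := pow2_ge_0 a; nra.
Qed.

Lemma cont_inv G : cont G x -> G x <> RtoC 0 -> cont (fun t => / G t)%C x.
Proof.
move=> [g1 g2] h.
have hn := Csq_neq0 h.
have hs : continuous (fun t => / (fst (G t) ^ 2 + snd (G t) ^ 2)) x.
  apply: (continuous_comp (fun t => fst (G t) ^ 2 + snd (G t) ^ 2) Rinv);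
    last exact: continuous_Rinv.
  by apply: continuous_plus; rewrite /=; apply: continuous_mult => //;
    apply: continuous_mult => //; apply: continuous_const.
split => /=; apply: continuous_mult => //.
exact: continuous_opp.
Qed.

Lemma cont_ext_loc G H : locally x (fun t => G t = H t) -> cont G x -> cont H x.
Proof.
move=> h [g1 g2]; split.
  by apply: continuous_ext_loc g1; apply: filter_imp h => t ->.
by apply: continuous_ext_loc g2; apply: filter_imp h => t ->.
Qed.

Lemma cont_comp (g : T -> C) (G : C -> C) :
  cont g x -> cont (T := C_UniformSpace) G (g x) -> cont (fun t => G (g t)) x.
Proof.
move=> [g1 g2] [h1 h2]; split.
  have := continuous_comp_2 (fun t => fst (g t)) (fun t => snd (g t)) (fun a b =>
    fst (G (a, b))) x g1 g2.
  move=> h; apply: continuous_ext (h _) => [t|]; first by case: (g t).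
  move: h1; rewrite {1}(surjective_pairing (g x)) => h1.
  by apply: continuous_ext h1 => -[].
have := continuous_comp_2 (fun t => fst (g t)) (fun t => snd (g t)) (fun a b =>
  snd (G (a, b))) x g1 g2.
move=> h; apply: continuous_ext (h _) => [t|]; first by case: (g t).
move: h2; rewrite {1}(surjective_pairing (g x)) => h2.
by apply: continuous_ext h2 => -[].
Qed.

Lemma cont_neq0 G : cont G x -> G x <> RtoC 0 -> locally x (fun t => G t <> RtoC 0).
Proof.
move=> [g1 g2] h; have hn := Csq_neq0 h.
have hs : continuous (fun t => fst (G t) ^ 2 + snd (G t) ^ 2) x.
  by apply: continuous_plus; rewrite /=; apply: continuous_mult => //;
    apply: continuous_mult => //; apply: continuous_const.
have h2 : locally x (fun t => fst (G t) ^ 2 + snd (G t) ^ 2 <> 0)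
  by exact: hs _ (open_neq 0 _ hn).
by apply: filter_imp h2 => t ht e; apply: ht; rewrite e /=; ring.
Qed.
End Cont.

Notation ccont := (cont (T := C_UniformSpace)).

Lemma locally_Cmod (z : C) (P : C -> Prop) d : 0 < d ->
  (forall t : C, Cmod (t - z)%C < d -> P t) -> locally (T := C_UniformSpace) z P.
Proof.
move=> hd h; have hd2 : 0 < d / sqrt 2.
  by apply: Rdiv_lt_0_compat => //; apply: Rlt_sqrt2_0.
exists (mkposreal _ hd2) => t ht; apply: h.
have := C_NormedModule_mixin_compat2 _ _ _ ht; rewrite /=.
have -> : sqrt 2 * (d / sqrt 2) = d by field; apply: Rgt_not_eq; apply: Rlt_sqrt2_0.
by [].
Qed.

Lemma cont_id (z : C) : ccont (fun t : C => t) z.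
Proof. by split; [exact: continuous_fst | exact: continuous_snd]. Qed.

Lemma cont_lip (G : C -> C) z d K : 0 < d -> (forall t, Cmod (t - z)%C < d ->
  Cmod (G t - G z)%C <= K * Cmod (t - z)%C) -> ccont G z.
Proof.
move=> hd h.
have h' eps : 0 < eps -> locally (T := C_UniformSpace) z (fun t => Cmod (G t - G z)%C < eps).
  move=> he; have hK : 0 < Rabs K + 1 by have := Rabs_pos K; lra.
  apply: (@locally_Cmod _ _ (Rmin d (eps / (Rabs K + 1)))).
    by apply: Rmin_pos => //; apply: Rdiv_lt_0_compat.
  move=> t ht; have ht1 := Rlt_le_trans _ _ _ ht (Rmin_l _ _).
  have ht2 := Rlt_le_trans _ _ _ ht (Rmin_r _ _).
  apply: Rle_lt_trans (h t ht1) _; have h0 := Cmod_ge_0 (t - z)%C.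
  move/(Rlt_div_r _ _ _ hK): ht2 => ht2; have := Rle_abs K; nra.
split; apply/filterlim_locally => eps; apply: filter_imp (h' _ (cond_pos eps)) => t ht.
  rewrite /ball /= /AbsRing_ball /abs /= /minus /plus /opp /=.
  apply: Rle_lt_trans ht; exact: (re_le_Cmod (G t - G z)%C).
rewrite /ball /= /AbsRing_ball /abs /= /minus /plus /opp /=.
apply: Rle_lt_trans ht; apply: Rle_trans (Rmax_Cmod (G t - G z)%C); exact: Rmax_r.
Qed.

(** Caratheodory's form of differentiability, with respect to a coordinate e
that is the inclusion of R or the identity of C.  The same rules then cover
curves and holomorphic functions, and their proofs are algebra on phi. *)
Definition cder (T : UniformSpace) (e : T -> C) (G : T -> C) (x : T) (l : C) : Prop :=
  exists phi, [/\ cont phi x, phi x = l & locally x (fun t =>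
    G t = G x + (e t - e x) * phi t)%C].

Section Cder.
Variables (T : UniformSpace) (e : T -> C) (x : T).
Hypothesis he : cont e x.
Implicit Types G H : T -> C.

Lemma cder_cont G l : cder e G x l -> cont G x.
Proof.
case=> phi [h1 h2 h3].
apply: (@cont_ext_loc _ _ (fun t => G x + (e t + - e x) * phi t)%C).
  by apply: filter_imp h3 => t ->.
apply: cont_plus; first exact: cont_const.
apply: cont_mult => //; apply: cont_plus => //; exact: cont_const.
Qed.

Lemma cder_const a : cder e (fun _ => a) x (RtoC 0).
Proof.
exists (fun _ => RtoC 0); split => //; first exact: cont_const.
by apply: filter_forall => t; ring.
Qed.

Lemma cder_e : cder e e x (RtoC 1).
Proof.
exists (fun _ => RtoC 1); split => //; first exact: cont_const.
by apply: filter_forall => t; ring.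
Qed.

Lemma cder_plus G H l l' : cder e G x l -> cder e H x l' -> cder e (fun t =>
  G t + H t)%C x (l + l')%C.
Proof.
move=> [p [p1 p2 p3]] [q [q1 q2 q3]]; exists (fun t => p t + q t)%C; split.
- exact: cont_plus.
- by rewrite p2 q2.
- by apply: filter_imp (filter_and _ _ p3 q3) => t [-> ->]; ring.
Qed.

Lemma cder_mult G H l l' : cder e G x l -> cder e H x l' ->
  cder e (fun t => G t * H t)%C x (l * H x + G x * l')%C.
Proof.
move=> hG hH; have cH := cder_cont hH; move: hG hH.
move=> [p [p1 p2 p3]] [q [q1 q2 q3]]; exists (fun t => p t * H t + G x * q t)%C; split.
- apply: cont_plus; apply: cont_mult => //; exact: cont_const.
- by rewrite p2 q2.
- apply: filter_imp (filter_and _ _ p3 q3) => t [-> ->]; ring.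
Qed.

Lemma cder_inv G l : cder e G x l -> G x <> RtoC 0 ->
  cder e (fun t => / G t)%C x (- l * / (G x * G x))%C.
Proof.
move=> hG h0; have cG := cder_cont hG; case: hG => p [p1 p2 p3].
exists (fun t => - (1) * p t * / (G t * G x))%C; split.
- apply: cont_mult.
    by apply: cont_mult => //; exact: cont_const.
  apply: cont_inv; first by apply: cont_mult => //; exact: cont_const.
  by apply: Cmult_neq_0.
- rewrite p2; ring.
- apply: filter_imp (filter_and _ _ p3 (cont_neq0 cG h0)) => t [e1 e2].
  have e3 : ((e t - e x) * p t = G t - G x)%C by rewrite {1}e1; ring.
  have -> : ((e t - e x) * (- (1) * p t * / (G t * G x)) = - ((e t - e x) * p t) * / (G t *
    G x))%C by ring.
  by rewrite e3; field.
Qed.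

Lemma cder_ext_loc G H l : locally x (fun t => G t = H t) -> cder e G x l -> cder e H x l.
Proof.
move=> h [p [p1 p2 p3]]; exists p; split => //.
have hx := locally_singleton _ _ h.
by apply: filter_imp (filter_and _ _ h p3) => t [<- ->]; rewrite hx.
Qed.

Lemma cder_comp (g : T -> C) (G : C -> C) l l' : cder e g x l ->
  cder (T := C_UniformSpace) (fun t => t) G (g x) l' -> cder e (fun t => G (g t)) x (l * l')%C.
Proof.
move=> hg; have cg := cder_cont hg; case: hg => p [p1 p2 p3] [q [q1 q2 q3]].
exists (fun t => p t * q (g t))%C; split.
- by apply: cont_mult => //; apply: cont_comp.
- by rewrite p2 q2.
- have h : locally x (fun t => G (g t) = G (g x) + (g t - g x) * q (g t))%C.
    case: cg => c1 c2; case: q3 => d hd.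
    have h1 : locally x (fun t => ball (fst (g x)) d (fst (g t)))
      by exact: c1 _ (locally_ball _ _).
    have h2 : locally x (fun t => ball (snd (g x)) d (snd (g t)))
      by exact: c2 _ (locally_ball _ _).
    by apply: filter_imp (filter_and _ _ h1 h2) => t ht; exact: hd.
  by apply: filter_imp (filter_and _ _ p3 h) => t [h1 h2]; rewrite h2 h1; ring.
Qed.
End Cder.


Lemma locally_CmodE (z : C) (P : C -> Prop) : locally (T := C_UniformSpace) z P ->
  exists d, 0 < d /\ forall t : C, Cmod (t - z)%C < d -> P t.
Proof.
case=> d hd; exists d; split; first exact: cond_pos.
by move=> t ht; apply: hd; apply: C_NormedModule_mixin_compat1.
Qed.

Lemma Cmod_le_fst_snd (w : C) : Cmod w <= Rabs (fst w) + Rabs (snd w).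
Proof.
have -> : w = (RtoC (fst w) + Ci * RtoC (snd w))%C.
  by case: w => a b; rewrite /Ci /RtoC /Cplus /Cmult /=; congr pair; ring.
apply: Rle_trans (Cmod_triangle _ _) _; rewrite Cmod_mult Cmod_Ci !Cmod_R /= Rmult_1_l.
by right; congr (Rabs _ + Rabs _); ring.
Qed.

Lemma cont_eps (T : UniformSpace) (G : T -> C) x eps : 0 < eps -> cont G x ->
  locally x (fun t => Cmod (G t - G x)%C < eps).
Proof.
move=> he [c1 c2]; have he2 : 0 < eps / 2 by lra.
have h1 : locally x (fun t => Rabs (fst (G t) - fst (G x)) < eps / 2).
  exact: c1 _ (locally_ball _ (mkposreal _ he2)).
have h2 : locally x (fun t => Rabs (snd (G t) - snd (G x)) < eps / 2).
  exact: c2 _ (locally_ball _ (mkposreal _ he2)).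
apply: filter_imp (filter_and _ _ h1 h2) => t [H1 H2].
apply: Rle_lt_trans (Cmod_le_fst_snd _) _; rewrite /= -!/(Rminus _ _); lra.
Qed.

Notation cdiff := (cder (T := C_UniformSpace) (fun t : C => t)).
Notation rdiff := (cder (T := R_UniformSpace) RtoC).

Lemma cdiff_is_derive (G : C -> C) z l : cdiff G z l ->
  is_derive (K := C_AbsRing) (V := C_NormedModule) G z l.
Proof.
case=> p [p1 p2 p3]; split; first exact: is_linear_scal_l.
move=> x0 hx0.
have <- : z = x0 by apply: (is_filter_lim_locally_unique (K := C_AbsRing) (V :=
  AbsRing_NormedModule C_AbsRing)).
move=> eps.
have [d [hd h]] := locally_CmodE (filter_and _ _ p3 (cont_eps (cond_pos eps) p1)).
exists (mkposreal _ hd) => t ht; case: (h t ht) => e1 e2.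
rewrite /minus /plus /opp /scal /norm /= /mult /= e1.
have -> : (G z + (t - z) * p t + - G z + - ((t + - z) * l) = (p t - p z) * (t - z))%C
  by rewrite p2; ring.
rewrite Cmod_mult; apply: Rmult_le_compat_r; first exact: Cmod_ge_0.
by apply: Rlt_le.
Qed.

Lemma rdiff_is_derive (F : R -> C) s l : rdiff F s l -> is_derive (fun t =>
  fst (F t)) s (fst l).
Proof.
case=> p [p1 p2 p3]; apply/is_derive_Reals => eps he.
case: (filter_and _ _ p3 (cont_eps he p1)) => d hd; exists d => h h0 hh.
case: (hd (s + h)); first by rewrite /ball /= /AbsRing_ball /abs /minus /plus /opp /=;
  rewrite (_ : s + h + - s = h); [|ring].
move=> -> e2; apply: Rle_lt_trans e2.
apply: Rle_trans (re_le_Cmod _); right; congr Rabs; rewrite -p2 /=; field.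
by [].
Qed.

Lemma rdiff_of_is_derive (a b : R -> R) s a' b' : is_derive a s a' -> is_derive b s b' ->
  rdiff (fun t => (a t, b t)) s (a', b').
Proof.
move=> /is_derive_Reals ha /is_derive_Reals hb.
pose sl (f : R -> R) f' t := if Req_EM_T t s then f' else (f t - f s) / (t - s).
have sls (f : R -> R) f' : sl f f' s = f' by rewrite /sl; case: Req_EM_T.
have hsl (f : R -> R) f' : derivable_pt_lim f s f' -> continuous (sl f f') s.
  move=> hf; apply/filterlim_locally => eps; case: (hf _ (cond_pos eps)) => d hd.
  exists d => t ht; rewrite sls /sl.
  case: Req_EM_T => [e|hts]; first exact: ball_center.
  have h0 : t - s <> 0 by lra.
  have := hd (t - s) h0 ht; rewrite (_ : s + (t - s) = t); last by ring.
  by [].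
exists (fun t => (sl a a' t, sl b b' t)); split.
- by split; apply: hsl.
- by rewrite !sls.
- apply: filter_forall => t; rewrite /sl /RtoC /Cplus /Cminus /Copp /Cmult /= -/(Rminus _ _).
  case: Req_EM_T => [e|h] /=; first by rewrite e; congr pair; ring.
  by congr pair; field; lra.
Qed.

Lemma cont_RtoC s : cont (T := R_UniformSpace) RtoC s.
Proof. split; [exact: continuous_id | exact: continuous_const]. Qed.

(** * Holomorphic functions on annuli *)

Definition circ (r theta : R) : C := (RtoC r * (cos theta, sin theta))%C.

Lemma Cmod_cis theta : Cmod (cos theta, sin theta) = 1.
Proof.
have := sin2_cos2 theta; rewrite /Rsqr => h.
by rewrite /Cmod /= (_ : _ + _ = 1) ?sqrt_1 //; lra.
Qed.

Lemma Cmod_circ r theta : Cmod (circ r theta) = Rabs r.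
Proof. by rewrite /circ Cmod_mult Cmod_R Cmod_cis Rmult_1_r. Qed.

Lemma rdiff_circ_angle r theta : rdiff (circ r) theta (Ci * circ r theta)%C.
Proof.
have := rdiff_of_is_derive (is_derive_cos theta) (is_derive_sin theta).
move=> h; have := cder_mult (cont_RtoC theta) (cder_const RtoC theta (RtoC r)) h.
rewrite /circ; congr (rdiff _ _ _).
by rewrite /Ci /RtoC /Cplus /Cmult /=; congr pair; ring.
Qed.

Lemma rdiff_circ_radius r theta : rdiff (fun r => circ r theta) r (cos theta, sin theta).
Proof.
have := cder_mult (cont_RtoC r) (cder_e RtoC r) (cder_const RtoC r (cos theta, sin theta)).
rewrite /circ; congr (rdiff _ _ _).
by rewrite /RtoC /Cplus /Cmult /=; congr pair; ring.
Qed.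

(** A negative inner radius gives a disc. *)
Definition ann (a b : R) (t : C) : Prop := a < Cmod t < b.

(** Continuity of the derivative is part of the notion, since differentiating
under the integral sign requires it. *)
Definition hol (U : C -> Prop) (G : C -> C) : Prop :=
  exists dG : C -> C, forall z, U z -> ccont dG z /\ cdiff G z (dG z).

Lemma ann_open a b z : ann a b z -> locally (T := C_UniformSpace) z (ann a b).
Proof.
move=> [h1 h2]; apply: (@locally_Cmod _ _ (Rmin (Cmod z - a) (b - Cmod z))).
  by apply: Rmin_pos; lra.
move=> t ht; have := Rlt_le_trans _ _ _ ht (Rmin_l _ _);
  have := Rlt_le_trans _ _ _ ht (Rmin_r _ _).
have h3 := Cmod_le_sub z t; have h4 := Cmod_le_sub t z.
rewrite (_ : Cmod (z - t)%C = Cmod (t - z)%C) in h4; first by rewrite /ann; lra.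
by rewrite -Cmod_opp; congr Cmod; ring.
Qed.

Section Hol.
Variable U : C -> Prop.
Implicit Types G H : C -> C.

Lemma hol_const a : hol U (fun _ => a).
Proof. exists (fun _ => RtoC 0) => z _; split; [exact: cont_const | exact: cder_const]. Qed.

Lemma hol_id : hol U (fun t => t).
Proof. exists (fun _ => RtoC 1) => z _; split; [exact: cont_const | exact: cder_e]. Qed.

Lemma hol_cont G z : hol U G -> U z -> ccont G z.
Proof. by case=> dG h hz; case: (h z hz) => _; apply: cder_cont; exact: cont_id. Qed.

Lemma hol_plus G H : hol U G -> hol U H -> hol U (fun t => G t + H t)%C.
Proof.
move=> [dG hG] [dH hH]; exists (fun t => dG t + dH t)%C => z hz.
case: (hG z hz) (hH z hz) => g1 g2 [h1 h2].
by split; [apply: cont_plus | apply: cder_plus].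
Qed.

Lemma hol_mult G H : hol U G -> hol U H -> hol U (fun t => G t * H t)%C.
Proof.
move=> HG HH; have cG := hol_cont HG; have cH := hol_cont HH.
case: HG HH => [dG hG] [dH hH]; exists (fun t => dG t * H t + G t * dH t)%C => z hz.
case: (hG z hz) (hH z hz) => g1 g2 [h1 h2].
split; last by apply: cder_mult => //; exact: cont_id.
by apply: cont_plus; apply: cont_mult => //; [apply: cH | apply: cG].
Qed.

Lemma hol_inv G : (forall z, U z -> G z <> RtoC 0) -> hol U G -> hol U (fun t => / G t)%C.
Proof.
move=> h0 HG; have cG := hol_cont HG; case: HG => dG hG.
exists (fun t => - (1) * dG t * / (G t * G t))%C => z hz; case: (hG z hz) => g1 g2; split.
  apply: cont_mult; first by apply: cont_mult => //; exact: cont_const.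
  apply: cont_inv; first by apply: cont_mult; apply: cG.
  by apply: Cmult_neq_0; apply: h0.
have -> : (- (1) * dG z * / (G z * G z) = - dG z * / (G z * G z))%C by ring.
apply: cder_inv => //; [exact: cont_id | exact: h0].
Qed.

Lemma hol_opp G : hol U G -> hol U (fun t => - G t)%C.
Proof.
move=> h; have [dG hd] := hol_mult (hol_const (- (1))%C) h; exists dG => z hz.
case: (hd z hz) => h1 h2; split => //.
by apply: cder_ext_loc h2; apply: filter_forall => t; ring.
Qed.

Lemma hol_minus G H : hol U G -> hol U H -> hol U (fun t => G t - H t)%C.
Proof. by move=> hG hH; apply: hol_plus => //; apply: hol_opp. Qed.

Lemma hol_pow G n : hol U G -> hol U (fun t => G t ^ n)%C.
Proof.
move=> h; elim: n => [|n IH]; first exact: hol_const.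
exact: hol_mult.
Qed.
End Hol.

Lemma hol_sub (U V : C -> Prop) G : (forall z, V z -> U z) -> hol U G -> hol V G.
Proof. by move=> h [dG hG]; exists dG => z /h; apply: hG. Qed.

Lemma hol_ext a b G H : (forall t, ann a b t -> G t = H t) -> hol (ann a b) G ->
  hol (ann a b) H.
Proof.
move=> h [dG hG]; exists dG => z hz; case: (hG z hz) => h1 h2; split => //.
apply: cder_ext_loc h2; apply: filter_imp (ann_open hz); exact: h.
Qed.


(** * Means over circles *)

Definition is_mean (G : C -> C) (r : R) (l : C) : Prop :=
  is_RInt (V := C_R_NormedModule) (fun theta =>
    G (circ r theta)) 0 (2 * PI) (RtoC (2 * PI) * l)%C.

Lemma cont_continuous (F : R -> C) s : cont (T := R_UniformSpace) F s ->
  continuous (T := R_UniformSpace) (U := C_R_NormedModule) F s.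
Proof.
case=> c1 c2; apply/filterlim_locally => eps.
have h1 : locally s (fun t => ball (fst (F s)) eps (fst (F t))) := c1 _ (locally_ball _ eps).
have h2 : locally s (fun t => ball (snd (F s)) eps (snd (F t))) := c2 _ (locally_ball _ eps).
by apply: filter_imp (filter_and _ _ h1 h2) => t [H1 H2]; split.
Qed.

Lemma twopi_gt0 : 0 < 2 * PI. Proof. by have := PI_RGT_0; lra. Qed.
Lemma twopi_neq0 : RtoC (2 * PI) <> RtoC 0.
Proof. by move=> /RtoC_inj; have := twopi_gt0; lra. Qed.

Lemma is_mean_of_RInt G r l :
  is_RInt (V := C_R_NormedModule) (fun theta => G (circ r theta)) 0 (2 * PI) l ->
  is_mean G r (l / RtoC (2 * PI))%C.
Proof.
rewrite /is_mean (_ : (RtoC (2 * PI) * (l / RtoC (2 * PI)))%C = l) //.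
field; exact: twopi_neq0.
Qed.

Lemma circ_cont r theta : cont (circ r) theta.
Proof. exact: (cder_cont (cont_RtoC _) (rdiff_circ_angle r theta)). Qed.

Lemma ex_mean G r : (forall theta, ccont G (circ r theta)) -> exists l, is_mean G r l.
Proof.
move=> h; have [l hl] : ex_RInt (V := C_R_CompleteNormedModule) (fun theta =>
  G (circ r theta)) 0 (2 * PI).
  apply: ex_RInt_continuous => theta _; apply: cont_continuous.
  by apply: cont_comp => //; exact: circ_cont.
by exists (l / RtoC (2 * PI))%C; apply: is_mean_of_RInt.
Qed.

Lemma is_mean_unique G r l l' : is_mean G r l -> is_mean G r l' -> l = l'.
Proof.
move=> h h'; have e : (RtoC (2 * PI) * l = RtoC (2 * PI) * l')%C.
  by rewrite -(is_RInt_unique (V := C_R_CompleteNormedModule) _ _ _ _ h);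
     exact: (is_RInt_unique (V := C_R_CompleteNormedModule) _ _ _ _ h').
have -> : l = (RtoC (2 * PI) * l / RtoC (2 * PI))%C by field; exact: twopi_neq0.
rewrite e; field; exact: twopi_neq0.
Qed.

Lemma is_mean_ext G H r l : 0 <= r -> (forall t, Cmod t = r -> G t = H t) ->
  is_mean G r l -> is_mean H r l.
Proof.
move=> hr h; apply: is_RInt_ext => theta _; apply: h.
by rewrite Cmod_circ Rabs_pos_eq.
Qed.

Lemma is_mean_plus G H r l l' : is_mean G r l -> is_mean H r l' ->
  is_mean (fun t => G t + H t)%C r (l + l')%C.
Proof. by move=> h h'; rewrite /is_mean Cmult_plus_distr_l; apply: is_RInt_plus. Qed.

Lemma is_mean_re G r l : is_mean G r l ->
  is_RInt (fun theta => fst (G (circ r theta))) 0 (2 * PI) (2 * PI * fst l).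
Proof.
move=> h; have := is_RInt_fct_extend_fst _ _ _ _ h.
by rewrite /= Rmult_0_l Rminus_0_r.
Qed.

Lemma is_mean_im G r l : is_mean G r l ->
  is_RInt (fun theta => snd (G (circ r theta))) 0 (2 * PI) (2 * PI * snd l).
Proof.
move=> h; have := is_RInt_fct_extend_snd _ _ _ _ h.
by rewrite /= Rmult_0_l Rplus_0_r.
Qed.

Lemma is_mean_pair G r l :
  is_RInt (fun theta => fst (G (circ r theta))) 0 (2 * PI) (2 * PI * fst l) ->
  is_RInt (fun theta => snd (G (circ r theta))) 0 (2 * PI) (2 * PI * snd l) ->
  is_mean G r l.
Proof.
move=> h1 h2; rewrite /is_mean.
have -> : (RtoC (2 * PI) * l = (2 * PI * fst l, 2 * PI * snd l)%R)%C.
  by rewrite /Cmult /RtoC /=; congr pair; ring.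
exact: is_RInt_fct_extend_pair.
Qed.

Lemma is_mean_scal a G r l : is_mean G r l -> is_mean (fun t => a * G t)%C r (a * l)%C.
Proof.
move=> h; have h1 := is_mean_re h; have h2 := is_mean_im h.
apply: is_mean_pair => /=.
  have := is_RInt_minus _ _ _ _ _ _ (is_RInt_scal _ _ _ (fst a) _ h1) (is_RInt_scal _ _ _
    (snd a) _ h2).
  by rewrite (_ : 2 * PI * (fst a * fst l - snd a * snd l) = minus (scal (fst a) (2 * PI *
    fst l)) (scal (snd a) (2 * PI * snd l))) ;
    [|rewrite /minus /plus /opp /scal /= /mult /=; ring].
have := is_RInt_plus _ _ _ _ _ _ (is_RInt_scal _ _ _ (fst a) _ h2) (is_RInt_scal _ _ _ (snd
  a) _ h1).
by rewrite (_ : 2 * PI * (fst a * snd l + snd a * fst l) = plus (scal (fst a) (2 * PI * snd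
  l)) (scal (snd a) (2 * PI * fst l))) ;
    [|rewrite /plus /scal /= /mult /=; ring].
Qed.

Lemma is_mean_conj G r l : is_mean G r l -> is_mean (fun t => Cconj (G t)) r (Cconj l).
Proof.
move=> h; apply: is_mean_pair => /=; first exact: is_mean_re.
have := is_RInt_opp _ _ _ _ (is_mean_im h).
by rewrite /opp /= Ropp_mult_distr_r.
Qed.

Lemma is_mean_const a r : is_mean (fun _ => a) r a.
Proof.
rewrite /is_mean.
have -> : (RtoC (2 * PI) * a)%C = scal (V := C_R_NormedModule) (2 * PI - 0) a;
  last exact: is_RInt_const.
rewrite /scal /= /prod_scal /scal /= /mult /= /Cmult /=; congr pair; ring.
Qed.

Lemma is_mean_bound G r l M : 0 <= r -> (forall t, Cmod t = r -> Cmod (G t) <= M) ->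
  is_mean G r l -> Cmod l <= M.
Proof.
move=> hr h hl; have p0 := twopi_gt0.
have := norm_RInt_le_const (V := C_R_NormedModule) _ _ _ _ M (Rlt_le _ _ p0) _ hl.
have e (w : C) : norm (V := C_R_NormedModule) w = Cmod w by rewrite Cmod_norm.
rewrite e Cmod_mult Cmod_R Rabs_pos_eq ?Rminus_0_r; last exact: Rlt_le.
move=> H; apply: (Rmult_le_reg_l (2 * PI)) => //; apply: H => x _.
by rewrite e; apply: h; rewrite Cmod_circ Rabs_pos_eq.
Qed.

Lemma circ_2pi r : circ r (2 * PI) = circ r 0.
Proof. by rewrite /circ cos_2PI sin_2PI cos_0 sin_0. Qed.

Lemma ann_circ a b r theta : a < Rabs r < b -> ann a b (circ r theta).
Proof. by rewrite /ann Cmod_circ. Qed.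

Section MeanConst.
Variables (a b : R) (G dG : C -> C).
Hypothesis hG : forall z, ann a b z -> ccont dG z /\ cdiff G z (dG z).

Lemma ann_radius r : a < Rabs r < b -> locally r (fun r' : R => a < Rabs r' < b).
Proof.
move=> hr; have h : ann a b (RtoC r) by rewrite /ann Cmod_R.
case: (locally_CmodE (ann_open h)) => d [hd hd']; exists (mkposreal _ hd) => r' hr'.
have := hd' (RtoC r'); rewrite /ann Cmod_R; apply.
by rewrite -RtoC_minus Cmod_R.
Qed.

Lemma derive_radius r theta : a < Rabs r < b ->
  is_derive (fun u => fst (G (circ u theta))) r (fst ((cos theta, sin theta) * dG (circ r
    theta))%C).
Proof.
move=> hr; apply: rdiff_is_derive; apply: (cder_comp (cont_RtoC _) (rdiff_circ_radius r theta)).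
by case: (hG (ann_circ theta hr)).
Qed.

(** e^(i theta) G'(r e^(i theta)) is, up to the factor i r, the derivative of
G(r e^(i theta)) in theta, and so integrates to 0 over a period. *)
Lemma RInt_derive_radius r : a < Rabs r < b ->
  is_RInt (fun theta => fst ((cos theta, sin theta) * dG (circ r theta))%C) 0 (2 * PI) 0.
Proof.
move=> hr.
(* P is a periodic primitive; the one for r <> 0 is G(r e^(i theta)) / (i r),
   which has no meaning at r = 0, where the integrand is G'(0) e^(i theta) *)
have [P hP hP2] : exists2 P : R -> C, (forall theta,
    rdiff P theta ((cos theta, sin theta) * dG (circ r theta))%C) & P (2 * PI) = P 0.
  case: (Req_dec r 0) => [r0|r0].
    exists (fun theta => dG (RtoC 0) * (- Ci * circ 1 theta))%C => [theta|]; last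
      by rewrite circ_2pi.
    have hc := cder_const (T := R_UniformSpace) RtoC theta.
    have := cder_mult (cont_RtoC _) (hc (dG (RtoC 0))) (cder_mult (cont_RtoC _) (hc (-
      Ci)%C) (rdiff_circ_angle 1 theta)).
    congr (rdiff _ _ _); rewrite (_ : circ r theta = RtoC 0); last by rewrite /circ r0; ring.
    rewrite /circ; move: (dG _) (cos theta, sin theta) => u v.
    have hi : (Ci * Ci = - (1))%C by rewrite /Ci /Cmult /Copp /RtoC /=; congr pair; ring.
    have -> : (0 * (- Ci * (1 * v)) + u * (0 * (1 * v) + - Ci * (Ci * (1 * v))) = - (Ci *
      Ci) * (v * u))%C by ring.
    rewrite hi; ring.
  exists (fun theta => G (circ r theta) * (- Ci * / RtoC r))%C => [theta|]; last
    by rewrite circ_2pi.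
  have hc := cder_const (T := R_UniformSpace) RtoC theta.
  have h1 := cder_comp (cont_RtoC _) (rdiff_circ_angle r theta) (proj2 (hG (ann_circ theta
    hr))).
  have := cder_mult (cont_RtoC _) h1 (hc (- Ci * / RtoC r)%C).
  congr (rdiff _ _ _).
  have hi : (Ci * Ci = - (1))%C by rewrite /Ci /Cmult /Copp /RtoC /=; congr pair; ring.
  have hr0 : RtoC r <> RtoC 0 by move=> /RtoC_inj.
  move: (dG _) (G _) => u w; rewrite /circ; move: (cos theta, sin theta) => v.
  have -> : (Ci * (r * v) * u * (- Ci * / r) + w * 0 = - (Ci * Ci) * (r * / r) * (v * u))%C
    by ring.
  rewrite hi Cinv_r //; ring.
have := is_RInt_derive (V := R_CompleteNormedModule) (fun theta => fst (P theta))
  (fun theta => fst ((cos theta, sin theta) * dG (circ r theta))%C) 0 (2 * PI).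
rewrite hP2 (_ : minus _ _ = 0); last exact: (minus_eq_zero (G := R_AbelianGroup)).
apply=> theta _; first exact: rdiff_is_derive.
have c1 : cont (fun theta => (cos theta, sin theta)) theta.
  have := rdiff_circ_angle 1 theta => /(cder_cont (cont_RtoC _)).
  by apply: cont_ext_loc; apply: filter_forall => t; rewrite /circ Cmult_1_l.
have c2 : cont (fun theta => dG (circ r theta)) theta.
  by apply: cont_comp; [exact: circ_cont | case: (hG (ann_circ theta hr))].
by case: (cont_mult c1 c2).
Qed.

Lemma mean_re_derive r : a < Rabs r < b ->
  is_derive (fun r => RInt (fun theta => fst (G (circ r theta))) 0 (2 * PI)) r 0.
Proof.
move=> hr; have hloc := ann_radius hr.
have hD r' theta : a < Rabs r' < b ->
    Derive (fun u => fst (G (circ u theta))) r' = fst ((cos theta, sin theta) * dG (circ r'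
      theta))%C.
  by move=> h; apply: is_derive_unique; apply: derive_radius.
have e : RInt (fun theta => Derive (fun u => fst (G (circ u theta))) r) 0 (2 * PI) = 0.
  apply: eq_trans (is_RInt_unique _ _ _ _ (RInt_derive_radius hr)).
  by apply: RInt_ext => theta _; exact: hD.
rewrite -[X in is_derive _ _ X]e; apply: is_derive_RInt_param.
- by apply: filter_imp hloc => r' h theta _; eexists; apply: derive_radius.
- move=> theta _; apply/continuity_2d_pt_filterlim.
  have hl2 : locally (T := prod_UniformSpace R_UniformSpace R_UniformSpace) (r, theta)
      (fun z => fst ((cos z.2, sin z.2) * dG (circ z.1 z.2))%C
         = Derive (fun u => fst (G (circ u z.2))) z.1).
    case: hloc => d hd; exists d => -[r' t'] [h1 h2] /=.
    by rewrite hD //; apply: hd.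
  rewrite -(locally_singleton _ _ hl2).
  apply: (filterlim_ext_loc _ _ hl2).
  have c1 : cont (T := prod_UniformSpace R_UniformSpace R_UniformSpace) (fun z =>
    (cos z.2, sin z.2)) (r, theta).
    split; apply: (continuous_comp snd); try exact: continuous_snd;
      [exact: continuous_cos | exact: continuous_sin].
  have c2 : cont (T := prod_UniformSpace R_UniformSpace R_UniformSpace) (fun z =>
    circ z.1 z.2) (r, theta).
    apply: cont_mult => //; split; [exact: continuous_fst | exact: continuous_const].
  have c3 : cont (T := prod_UniformSpace R_UniformSpace R_UniformSpace) (fun z =>
    dG (circ z.1 z.2)) (r, theta).
    by apply: cont_comp => //; case: (hG (ann_circ theta hr)).
  by case: (cont_mult c1 c3).
- apply: filter_imp hloc => r' h;
  apply: (ex_RInt_continuous (V := R_CompleteNormedModule)) => theta _.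
  have c : cont (fun theta => G (circ r' theta)) theta.
    apply: cont_comp; first exact: circ_cont.
    case: (hG (ann_circ theta h)) => _; apply: cder_cont; exact: cont_id.
  by case: c.
Qed.

Lemma mean_re_const r1 r2 : 0 <= r1 -> a < r1 -> r1 <= r2 -> r2 < b ->
  RInt (fun theta => fst (G (circ r1 theta))) 0 (2 * PI)
  = RInt (fun theta => fst (G (circ r2 theta))) 0 (2 * PI).
Proof.
move=> h0 h1 h2 h3; case: h2 => [h2|->//].
apply: (eq_is_derive (V := R_NormedModule) (fun r => RInt (fun theta =>
  fst (G (circ r theta))) 0 (2 * PI))) => // t ht.
by apply: mean_re_derive; rewrite Rabs_pos_eq; lra.
Qed.
End MeanConst.

Lemma hol_mean a b G r : hol (ann a b) G -> 0 <= r -> a < r < b -> exists l, is_mean G r l.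
Proof.
move=> hG hr h; apply: ex_mean => theta; apply: (hol_cont hG).
by apply: ann_circ; rewrite Rabs_pos_eq.
Qed.

Lemma Re_eq_mean G r l : is_mean G r l ->
  RInt (fun theta => fst (G (circ r theta))) 0 (2 * PI) = 2 * PI * fst l.
Proof. by move=> h; apply: is_RInt_unique; apply: is_mean_re. Qed.

(** [mean_re_const] concerns real parts; the imaginary part of G is the real
part of - i G. *)
Lemma mean_const_le a b G r1 r2 l1 l2 : hol (ann a b) G -> 0 <= r1 -> a < r1 -> r1 <= r2 ->
  r2 < b ->
  is_mean G r1 l1 -> is_mean G r2 l2 -> l1 = l2.
Proof.
move=> [dG hG] h0 h1 h2 h3 m1 m2; have p0 := twopi_gt0.
have e1 := mean_re_const hG h0 h1 h2 h3.
rewrite (Re_eq_mean m1) (Re_eq_mean m2) in e1.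
have [dH hH] := hol_mult (hol_const _ (- Ci)%C) (ex_intro _ dG hG).
have e2 := mean_re_const hH h0 h1 h2 h3.
rewrite (Re_eq_mean (is_mean_scal (a := (- Ci)%C) m1)) (Re_eq_mean (is_mean_scal (a := (-
  Ci)%C) m2)) /= in e2.
move: e1 e2; case: l1 {m1} => x y; case: l2 {m2} => x' y' /= e1 e2.
by congr pair; nra.
Qed.

Lemma mean_const a b G r1 r2 l : hol (ann a b) G -> 0 <= r1 -> 0 <= r2 -> a < r1 < b ->
  a < r2 < b ->
  is_mean G r1 l -> is_mean G r2 l.
Proof.
move=> hG p1 p2 h1 h2 m1; have [l2 m2] := hol_mean hG p2 h2.
case: (Rle_lt_dec r1 r2) => h.
  by rewrite (mean_const_le hG p1 (proj1 h1) h (proj2 h2) m1 m2).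
by rewrite -(mean_const_le hG p2 (proj1 h2) (Rlt_le _ _ h) (proj2 h1) m2 m1).
Qed.

Lemma mean_disc b G r : hol (ann (-1) b) G -> 0 <= r -> r < b -> is_mean G r (G (RtoC 0)).
Proof.
move=> hG p h; apply: (mean_const (r1 := 0) hG) => //; try lra.
have : is_mean (fun _ => G (RtoC 0)) 0 (G (RtoC 0)) by exact: is_mean_const.
apply: is_RInt_ext => theta _.
by rewrite /circ Cmult_0_l.
Qed.


(** * Difference quotients and residues *)

Notation disc := (ann (-1) 1).

Lemma disc_lt t : Cmod t < 1 -> disc t.
Proof. by have := Cmod_ge_0 t; rewrite /ann; lra. Qed.

Lemma psum_cont a z : tame a -> Cmod z < 1 -> ccont (psum a) z.
Proof.
move=> ha hz; have hQ := tame_quot ha hz.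
have h0 := Cmod_ge_0 z; set rho := (1 + Cmod z) / 2; have hr : 0 < rho < 1 by rewrite /rho; lra.
case: (hQ _ hr) => M hM.
set d := (rho - Cmod z) / 2; have hd : 0 < d by rewrite /d /rho; lra.
apply: (cont_lip (d := d) (K := M * / (1 - (Cmod z + d) / rho))) => // t ht.
have ht1 : Cmod t <= Cmod z + d.
  have := Cmod_le_sub t z; rewrite (_ : Cmod (z - t)%C = Cmod (t - z)%C); first lra.
  by rewrite -Cmod_opp; congr Cmod; ring.
have hdr : Cmod z + d < rho by rewrite /d /rho; lra.
have ht2 : Cmod t < rho by lra.
rewrite (psum_quot (t := t) ha hz); last lra.
rewrite (_ : (_ - _)%C = ((t - z) * psum (quot a z) t)%C); last by ring.
rewrite Cmod_mult Rmult_comm; apply: Rmult_le_compat_r; first exact: Cmod_ge_0.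
apply: Rle_trans (psum_bound hr ht2 hM hQ) _.
have hq : (Cmod z + d) / rho < 1 by apply/Rlt_div_l; lra.
have hq2 : Cmod t / rho <= (Cmod z + d) / rho.
  by apply: Rmult_le_compat_r ht1; apply/Rlt_le/Rinv_0_lt_compat; lra.
apply: Rmult_le_compat_l; last by apply: Rinv_le_contravar; lra.
by apply: Rle_trans (hM 0%nat); apply: Rmult_le_pos; [exact: Cmod_ge_0 | rewrite /=; lra].
Qed.

Lemma psum_cdiff a z : tame a -> Cmod z < 1 -> cdiff (psum a) z (psum (deriv a) z).
Proof.
move=> ha hz; exists (psum (quot a z)); split.
- by apply: psum_cont => //; apply: tame_quot.
- exact: psum_deriv.
- apply: filter_imp (ann_open (disc_lt hz)) => t [_ ht]; exact: psum_quot.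
Qed.

Lemma hol_psum a : tame a -> hol disc (psum a).
Proof.
move=> ha; exists (psum (deriv a)) => z [_ hz]; split; last exact: psum_cdiff.
by apply: psum_cont => //; apply: tame_deriv.
Qed.

(** Functions whose difference quotient at z extends holomorphically.  Power
series belong to the class by synthetic division, and the ring operations and
inverses preserve it. *)
Definition dquot_hol a b (z : C) (P : C -> C) : Prop :=
  hol (ann a b) P /\ exists2 n, hol (ann a b) n & forall t, ann a b t ->
    P t = (P z + (t - z) * n t)%C.

Section Dq.
Variables (a b : R) (z : C).
Hypothesis hz : ann a b z.

Lemma dquot_hol_mult P Q : dquot_hol a b z P -> dquot_hol a b z Q ->
  dquot_hol a b z (fun t => P t * Q t)%C.
Proof.
move=> [hP [n hn en]] [hQ [m hm em]]; split; first exact: hol_mult.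
exists (fun t => n t * Q t + P z * m t)%C.
  apply: hol_plus; apply: hol_mult => //; exact: hol_const.
by move=> t ht; rewrite (en t ht) {1}(em t ht) [in RHS](em t ht); ring.
Qed.

Lemma dquot_hol_plus P Q : dquot_hol a b z P -> dquot_hol a b z Q ->
  dquot_hol a b z (fun t => P t + Q t)%C.
Proof.
move=> [hP [n hn en]] [hQ [m hm em]]; split; first exact: hol_plus.
exists (fun t => n t + m t)%C; first exact: hol_plus.
by move=> t ht; rewrite (en t ht) (em t ht); ring.
Qed.

Lemma dquot_hol_inv P : (forall t, ann a b t -> P t <> RtoC 0) -> dquot_hol a b z P ->
  dquot_hol a b z (fun t => / P t)%C.
Proof.
move=> h0 [hP [n hn en]]; split; first exact: hol_inv.
exists (fun t => - n t * / (P t * P z))%C.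
  apply: hol_mult; first exact: hol_opp.
  apply: hol_inv => [t ht|]; first by apply: Cmult_neq_0; apply: h0.
  by apply: hol_mult => //; exact: hol_const.
move=> t ht; have h1 := h0 t ht; have h2 := h0 z hz; have e := en t ht.
have e' : ((t - z) * n t = P t - P z)%C by rewrite e; ring.
have -> : (/ P z + (t - z) * (- n t * / (P t * P z)) = / P z - ((t - z) * n t) * / (P t * P
  z))%C by ring.
by rewrite e'; field.
Qed.

Lemma dquot_hol_const c : dquot_hol a b z (fun _ => c).
Proof. by split; [exact: hol_const | exists (fun _ => RtoC 0) => [|t _];
  [exact: hol_const | ring]]. Qed.

Lemma dquot_hol_id : dquot_hol a b z (fun t => t).
Proof. by split; [exact: hol_id | exists (fun _ => RtoC 1) => [|t _];
  [exact: hol_const | ring]]. Qed.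

Lemma dquot_hol_pow P n : dquot_hol a b z P -> dquot_hol a b z (fun t => P t ^ n)%C.
Proof. by move=> h; elim: n => [|n IH]; [exact: dquot_hol_const | exact: dquot_hol_mult]. Qed.
End Dq.

Lemma ann_sub a b a' b' t : a <= a' -> b' <= b -> ann a' b' t -> ann a b t.
Proof. by rewrite /ann; lra. Qed.

Lemma dquot_hol_psum c a b z : tame c -> -1 <= a -> b <= 1 -> ann a b z ->
  dquot_hol a b z (psum c).
Proof.
move=> hc ha hb hz; have hd t : ann a b t -> disc t by apply: ann_sub.
split; first exact: hol_sub hd (hol_psum hc).
exists (psum (quot c z)); first by apply: (hol_sub hd); apply: hol_psum;
  apply: tame_quot => //; case: (hd z hz).
by move=> t /hd[_ ht]; apply: psum_quot => //; case: (hd z hz).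
Qed.

Lemma mul_conj_circle (t : C) r : Cmod t = r -> (t * Cconj t = RtoC (r ^ 2))%C.
Proof. by move=> <-; rewrite -Cmod2_conj RtoC_pow. Qed.

Lemma Cneq0_Cmod (t : C) : 0 < Cmod t -> t <> RtoC 0.
Proof. by move/Cmod_gt_0. Qed.

Lemma Csub_neq0 (t z : C) : Cmod t <> Cmod z -> (t - z)%C <> RtoC 0.
Proof.
move=> h e; apply: h; congr Cmod.
have -> : t = (t - z + z)%C by ring.
rewrite e; ring.
Qed.

(** On |t| = r one has 1/t = conj(t) / r^2, so the mean is the conjugate of that
of t^N / r^(2N), which is its value at 0. *)
Lemma mean_inv_pow N r : 0 < r -> (0 < N)%nat -> is_mean (fun t => / t ^ N)%C r (RtoC 0).
Proof.
move=> hr hN.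
have h : is_mean (fun t => t ^ N * / (RtoC (r ^ 2) ^ N))%C r (RtoC 0).
  have -> : RtoC 0 = ((RtoC 0) ^ N * / (RtoC (r ^ 2) ^ N))%C by case: N hN => // N _ /=; ring.
  apply: (@mean_disc (r + 1) (fun t => t ^ N * / (RtoC (r ^ 2) ^ N))%C r); try lra.
  by apply: hol_mult; [apply: hol_pow; exact: hol_id | exact: hol_const].
have := is_mean_conj h; rewrite (_ : Cconj (RtoC 0) = RtoC 0); last first.
  by rewrite /Cconj /RtoC /=; congr pair; ring.
apply: is_mean_ext; first lra.
move=> t ht; have h0 : t <> RtoC 0 by apply: Cneq0_Cmod; lra.
have hr2 : RtoC (r ^ 2) <> RtoC 0 by move=> /RtoC_inj; apply: pow_nonzero; lra.
have ec : Cconj (RtoC (r ^ 2)) = RtoC (r ^ 2) by rewrite /Cconj /RtoC /=; congr pair; ring.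
rewrite Cmult_conj Cinv_conj; last exact: Cpow_nz.
rewrite !Cpow_conj ec -(mul_conj_circle ht) Cpow_mult_l.
have hc : Cconj t <> RtoC 0.
  by move=> e; apply: hr2; rewrite -(mul_conj_circle ht) e; ring.
by field; split; apply: Cpow_nz.
Qed.

(** On |t| = r one has 1/(t - z) = conj(t / (r^2 - conj(z) t)), and the function
under the conjugation is holomorphic on a disc of radius greater than r. *)
Lemma mean_inv_sub_out z r : Cmod z < r -> is_mean (fun t => / (t - z))%C r (RtoC 0).
Proof.
move=> hz; have h0 := Cmod_ge_0 z; have hr : 0 < r by lra.
(* any radius strictly between r and r^2 / |z| serves; this one also makes
   sense for z = 0 *)
have hden t : Cmod t < 2 * r ^ 2 / (r + Cmod z) -> (RtoC (r ^ 2) - Cconj z * t)%C <> RtoC 0.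
  move=> ht; apply: Csub_neq0; rewrite Cmod_mult Cmod_conj Cmod_R Rabs_pos_eq;
    last exact: pow2_ge_0.
  move/(Rlt_div_r _ _ _): ht => ht; have := ht ltac:(lra) => {}ht.
  have := Cmod_ge_0 t => h1; apply: Rgt_not_eq.
  case: (Req_dec (Cmod z) 0) => [->|hz0]; first by rewrite Rmult_0_l; apply: pow_lt.
  nra.
have hb : r < 2 * r ^ 2 / (r + Cmod z) by apply/Rlt_div_r; nra.
have h : is_mean (fun t => t * / (RtoC (r ^ 2) - Cconj z * t))%C r (RtoC 0).
  have -> : RtoC 0 = (RtoC 0 * / (RtoC (r ^ 2) - Cconj z * RtoC 0))%C by ring.
  apply: (@mean_disc (2 * r ^ 2 / (r + Cmod z)) (fun t =>
    t * / (RtoC (r ^ 2) - Cconj z * t))%C r); try lra.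
  apply: hol_mult; first exact: hol_id.
  apply: hol_inv => [t [_ ht]|]; first exact: hden.
  apply: hol_minus; first exact: hol_const.
  by apply: hol_mult; [exact: hol_const | exact: hol_id].
have := is_mean_conj h; rewrite (_ : Cconj (RtoC 0) = RtoC 0); last first.
  by rewrite /Cconj /RtoC /=; congr pair; ring.
apply: is_mean_ext; first lra.
move=> t ht.
have hd : (RtoC (r ^ 2) - Cconj z * t)%C <> RtoC 0 by apply: hden; lra.
have ec : Cconj (RtoC (r ^ 2)) = RtoC (r ^ 2) by rewrite /Cconj /RtoC /=; congr pair; ring.
rewrite Cmult_conj Cinv_conj // Cminus_conj Cmult_conj Cconj_conj ec -(mul_conj_circle ht).
have hz' : (t - z)%C <> RtoC 0 by apply: Csub_neq0; lra.
have hc : Cconj t <> RtoC 0.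
  move=> e; have := Cmod_conj t; rewrite e Cmod_0; lra.
rewrite (_ : (t * Cconj t - z * Cconj t = Cconj t * (t - z))%C); last by ring.
by field.
Qed.

Lemma mean_inv_sub_in z r : 0 <= r -> r < Cmod z -> is_mean (fun t => / (t - z))%C r (- / z)%C.
Proof.
move=> hr hz.
have h0 : z <> RtoC 0 by apply: Cneq0_Cmod; lra.
have hn : (RtoC 0 - z)%C <> RtoC 0 by apply: Csub_neq0; rewrite Cmod_0; lra.
have -> : (- / z = / (RtoC 0 - z))%C.
  have e : ((RtoC 0 - z) * (- / z) = 1)%C by field.
  by rewrite -[LHS]Cmult_1_l -(Cinv_l _ hn) -Cmult_assoc e Cmult_1_r.
apply: (@mean_disc (Cmod z) (fun t => / (t - z))%C r) => //.
apply: hol_inv => [t [_ ht]|]; first by apply: Csub_neq0; lra.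
by apply: hol_minus; [exact: hol_id | exact: hol_const].
Qed.

(** Subtracting P(z)/(t - z) leaves the difference quotient of P, holomorphic
across z, while the mean of 1/(t - z) jumps from -1/z to 0. *)
Lemma mean_cross z rho r P l : 0 < rho -> rho < Cmod z -> Cmod z < r -> r < 1 ->
  dquot_hol 0 1 z P -> is_mean (fun t => P t * / (t - z))%C rho l ->
  is_mean (fun t => P t * / (t - z))%C r (l + P z * / z)%C.
Proof.
move=> h1 h2 h3 h4 [hP [n hn en]] hl.
have [v hv] : exists v, is_mean n rho v by apply: hol_mean hn _ _; lra.
have hv' : is_mean n r v by apply: mean_const hn _ _ _ _ hv; lra.
have e s : 0 < s < 1 -> s <> Cmod z -> forall t, Cmod t = s ->
    (n t + P z * / (t - z) = P t * / (t - z))%C.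
  move=> hs hsz t ht; have ht' : ann 0 1 t by rewrite /ann ht.
  have h0 : (t - z)%C <> RtoC 0 by apply: Csub_neq0; rewrite ht.
  by rewrite (en t ht'); field.
have m1 := is_mean_ext (Rlt_le _ _ h1) (e rho ltac:(lra) ltac:(lra))
  (is_mean_plus hv (is_mean_scal (a := P z) (mean_inv_sub_in (Rlt_le _ _ h1) h2))).
have hr0 : 0 <= r by lra.
have m2 := is_mean_ext hr0 (e r ltac:(lra) ltac:(lra))
  (is_mean_plus hv' (is_mean_scal (a := P z) (mean_inv_sub_out h3))).
rewrite (is_mean_unique hl m1).
by rewrite (_ : (v + P z * - / z + P z * / z = v + P z * 0)%C); last by ring.
Qed.

(** * Taylor coefficients *)

(** Taylor coefficients as Cauchy integrals, for functions that need not be given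
by a power series, such as negative powers of f(t)/t. *)
Definition coefs (H : C -> C) (h : nat -> C) : Prop :=
  forall r N, 0 < r < 1 -> is_mean (fun t => H t * / t ^ N)%C r (h N).

Lemma hol_inv_pow N b : hol (ann 0 b) (fun t => / t ^ N)%C.
Proof.
apply: hol_inv => [t [ht _]|]; first by apply/Cpow_nz/Cneq0_Cmod.
by apply: hol_pow; exact: hol_id.
Qed.

Lemma coefs_ex H : hol disc H -> exists h, coefs H h.
Proof.
move=> hH.
have hd t : ann 0 1 t -> disc t by apply: ann_sub; lra.
have hN N : hol (ann 0 1) (fun t => H t * / t ^ N)%C.
  by apply: hol_mult; [apply: hol_sub hd hH | exact: hol_inv_pow].
have h N : exists l, is_mean (fun t => H t * / t ^ N)%C (1 / 2) l
  by apply: hol_mean (hN N) _ _; lra.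
exists (fun N => iota (T := C_CompleteNormedModule) (is_mean (fun t =>
  H t * / t ^ N)%C (1 / 2))) => r N hr.
have [l hl] := h N; have : is_mean (fun t => H t * / t ^ N)%C r l
  by apply: mean_const (hN N) _ _ _ _ hl; lra.
congr is_mean; apply/esym.
apply: (is_mean_unique _ hl); apply: (iota_correct (V := C_CompleteNormedModule)).
by exists l; split => // l'; apply: is_mean_unique.
Qed.

Lemma coefs_unique H h h' N : coefs H h -> coefs H h' -> h N = h' N.
Proof. by move=> h1 h2; apply: is_mean_unique (h1 (1 / 2) N _) (h2 _ N _); lra. Qed.

Lemma coefs_ext H H' h : (forall t, Cmod t < 1 -> H t = H' t) -> coefs H h -> coefs H' h.
Proof.
move=> e hh r N hr; apply: is_mean_ext (hh r N hr); first lra.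
by move=> t ht; rewrite e //; lra.
Qed.

Lemma coefs_one : coefs (fun _ => RtoC 1) (fun N => if N is 0%nat then RtoC 1 else RtoC 0).
Proof.
move=> r [|N] hr.
  have : is_mean (fun _ => RtoC 1) r (RtoC 1) by exact: is_mean_const.
  by apply: is_mean_ext => [|t _ /=]; [lra | field].
apply: is_mean_ext (mean_inv_pow _ (ltn0Sn N)); [lra | move=> t _; ring | lra].
Qed.


Lemma is_mean_sum n (F : nat -> C -> C) (l : nat -> C) r :
  (forall i, (i < n)%nat -> is_mean (F i) r (l i)) ->
  is_mean (fun t => \big[Cplus/RtoC 0]_(i < n) F i t) r (\big[Cplus/RtoC 0]_(i < n) l i).
Proof.
move=> h; elim: n h => [|n IH] h.
  rewrite big_ord0 /is_mean; have : is_mean (fun _ => RtoC 0) r (RtoC 0)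
    by exact: is_mean_const.
  by apply: is_RInt_ext => theta _; rewrite big_ord0.
rewrite big_ord_recr /=.
have := is_mean_plus (IH _) (h n (ltnSn n)); rewrite /is_mean => H.
apply: is_RInt_ext (H _) => [theta _|i hi]; first by rewrite big_ord_recr.
by apply: h; apply: ltnW.
Qed.

Lemma psum_expand a n t : tame a -> Cmod t < 1 ->
  psum a t = (\big[Cplus/RtoC 0]_(i < n) (a i * t ^ i) + t ^ n * psum (shift n a) t)%C.
Proof.
move=> ha ht; elim: n => [|n IH].
  by rewrite big_ord0 /= Cplus_0_l Cmult_1_l; apply: psum_ext.
rewrite IH big_ord_recr /= -Cplus_assoc; congr Cplus.
rewrite -!/(tails a t _) tails_rec //; ring.
Qed.

Lemma Cpow_sub (t : C) i N : t <> RtoC 0 -> (i <= N)%nat -> (t ^ i * / t ^ N = / t ^ (N - i))%C.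
Proof.
move=> h0 hi; rewrite -{1}(subnK hi) (Cpow_add_r t (N - i) i).
by field; split; apply: Cpow_nz.
Qed.

(** Split the first factor into its Taylor polynomial of degree N and a
remainder t^(N+1) R(t): the latter contributes the mean of t R(t) H(t), which is
its value at 0. *)
Lemma coefs_mult a H h : tame a -> hol disc H -> coefs H h ->
  coefs (fun t => psum a t * H t)%C (fun N =>
    \big[Cplus/RtoC 0]_(i < N.+1) (a i * h (N - i)%nat)%C).
Proof.
move=> ha hH hh r N hr.
have m1 : is_mean (fun t => \big[Cplus/RtoC 0]_(i < N.+1) (a i * (H t * / t ^ (N - i)))%C) r
    (\big[Cplus/RtoC 0]_(i < N.+1) (a i * h (N - i)%nat)%C).
  by apply: (is_mean_sum (F := fun i t => (a i * (H t * / t ^ (N - i)))%C)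
      (l := fun i => (a i * h (N - i)%nat)%C)) => i _; apply: is_mean_scal; apply: hh.
have m2 : is_mean (fun t => t * (psum (shift N.+1 a) t * H t))%C r (RtoC 0).
  have e : RtoC 0 = (RtoC 0 * (psum (shift N.+1 a) (RtoC 0) * H (RtoC 0)))%C by ring.
  rewrite e; apply: (@mean_disc 1 (fun t => t * (psum (shift N.+1 a) t * H t))%C); try lra.
  apply: hol_mult; first exact: hol_id.
  by apply: hol_mult => //; apply: hol_psum; apply: tame_shift.
have := is_mean_plus m1 m2; rewrite Cplus_0_r; apply: is_mean_ext; first lra.
move=> t ht; have h0 : t <> RtoC 0 by apply: Cneq0_Cmod; lra.
rewrite (psum_expand N.+1 ha); last lra.
rewrite !Cmult_plus_distr_r; congr Cplus.
  rewrite -Cmult_assoc big_distrl /=; apply: eq_bigr => i _.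
  rewrite -(Cpow_sub h0); [ring | by rewrite -ltnS].
by rewrite /=; field; apply: Cpow_nz.
Qed.

(** Power series with constant term 1 can be cancelled. *)
Lemma conv_inj (a h h' : nat -> C) : a 0%nat = RtoC 1 ->
  (forall N, \big[Cplus/RtoC 0]_(i < N.+1) (a i * h (N - i)%nat)%C
    = \big[Cplus/RtoC 0]_(i < N.+1) (a i * h' (N - i)%nat)%C) -> forall N, h N = h' N.
Proof.
move=> a0 e N; elim: N {-2}N (leqnn N) => [|n IH] N hN.
  by have := e 0%nat; rewrite !big_ord_recl !big_ord0 /= a0 (_ : N = 0%nat) ?subn0; [|lia];
     rewrite !Cplus_0_r !Cmult_1_l.
have := e N; rewrite !big_ord_recl /= subn0 a0 !Cmult_1_l.
rewrite [X in (_ = _ + X)%C -> _](eq_bigr (fun i : 'I_N =>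
  a (bump 0 i) * h (N - bump 0 i)%nat)%C).
  move=> E.
  move: (h N) (h' N) (\big[Cplus/_]_(_ < _) _) E => x y s E.
  have -> : x = (x + s - s)%C by ring.
  by rewrite E; ring.
by move=> i _; rewrite IH //; have := ltn_ord i; rewrite /bump /=; lia.
Qed.

Lemma CpowZ_succ (w : C) n : w <> RtoC 0 -> CpowZ w (n + 1) = (w * CpowZ w n)%C.
Proof.
move=> h; case: n => [|p|p].
- by rewrite /= Cmult_1_r.
- rewrite -[(Z.pos p + 1)%Z]/(Z.pos (p + 1)) /CpowZ Pos2Nat.inj_add Cpow_add_r /=; ring.
- case: (Pos.eq_dec p 1) => [->|hp]; first by rewrite /=; field.
  have -> : (Z.neg p + 1 = Z.neg (p - 1))%Z by lia.
  have e : Pos.to_nat p = (Pos.to_nat (p - 1)).+1 by lia.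
  by rewrite /CpowZ e /=; field; split => //; apply: Cpow_nz.
Qed.

Lemma CpowZ_nat (w : C) n : CpowZ w (Z.of_nat n) = (w ^ n)%C.
Proof. by case: n => [|n] //; rewrite /CpowZ /= SuccNat2Pos.id_succ. Qed.

Lemma CpowZ_opp (w : C) n : w <> RtoC 0 -> CpowZ w (- Z.of_nat n) = (/ w ^ n)%C.
Proof.
move=> h; case: n => [|n]; first by rewrite /=; field.
by rewrite /CpowZ /= SuccNat2Pos.id_succ.
Qed.

Lemma hol_CpowZ b G n : (forall t, ann (-1) b t -> G t <> RtoC 0) -> hol (ann (-1) b) G ->
  hol (ann (-1) b) (fun t => CpowZ (G t) n).
Proof.
move=> h0 hG; case: n => [|p|p]; [exact: hol_const | exact: hol_pow |].
by apply: hol_inv => [t ht|]; [apply/Cpow_nz/h0 | exact: hol_pow].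
Qed.

Lemma coefs_proper H h h' : (forall N, h N = h' N) -> coefs H h -> coefs H h'.
Proof. by move=> e hh r N hr; rewrite -e; apply: hh. Qed.

(** * Order of vanishing *)

Fixpoint iquot (z : C) (a : nat -> C) (m : nat) : nat -> C :=
  if m is m'.+1 then quot (iquot z a m') z else a.

Lemma tame_iquot z a m : tame a -> Cmod z < 1 -> tame (iquot z a m).
Proof. by move=> ha hz; elim: m => //= m IH; apply: tame_quot. Qed.

Lemma psum_iquot z a m t : tame a -> Cmod z < 1 -> Cmod t < 1 ->
  (forall i, (i < m)%nat -> psum (iquot z a i) z = RtoC 0) ->
  psum a t = ((t - z) ^ m * psum (iquot z a m) t)%C.
Proof.
move=> ha hz ht; elim: m => [|m IH] h; first by rewrite /= Cmult_1_l.
rewrite IH => [|i hi]; last by apply: h; apply: ltnW.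
rewrite (psum_quot (z := z)) //; last exact: tame_iquot.
rewrite h //= ; ring.
Qed.

(** With F = (t - z)^m q_m for every m, the function
G_m = q_m (R^2 - conj(z) t)^m has modulus R^m |F| on |t| = R, so by the mean value
property |G_m(0)| <= K R^m, that is |F(0)| <= K (|z| / R)^m.  This is Schwarz's
lemma with Blaschke factors. *)
Lemma infinite_order z a : tame a -> Cmod z < 1 ->
  (forall i, psum (iquot z a i) z = RtoC 0) -> psum a (RtoC 0) = RtoC 0.
Proof.
move=> ha hz h; have h0 := Cmod_ge_0 z.
set R := (1 + Cmod z) / 2; have hR : 0 < R < 1 by rewrite /R; lra.
have hzR : Cmod z < R by rewrite /R; lra.
have [K hK] : exists K, forall t, Cmod t = R -> Cmod (psum a t) <= K.
  set s := (1 + R) / 2; have hs : 0 < s < 1 by rewrite /s; lra.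
  case: (ha _ hs) => M hM; exists (M * / (1 - R / s)) => t ht.
  by rewrite -ht; apply: psum_bound => //; rewrite ht /s; lra.
have bnd m : Cmod (psum a (RtoC 0)) <= K * (Cmod z / R) ^ m.
  pose q := iquot z a m; have hq : tame q by apply: tame_iquot.
  have eq t : Cmod t < 1 -> psum a t = ((t - z) ^ m * psum q t)%C by move=> ht;
    apply: psum_iquot.
  pose G t := (psum q t * (RtoC (R ^ 2) - Cconj z * t) ^ m)%C.
  have hG : hol disc G.
    apply: hol_mult; first exact: hol_psum.
    apply: hol_pow; apply: hol_minus; first exact: hol_const.
    by apply: hol_mult; [exact: hol_const | exact: hol_id].
  have mG := mean_disc hG (Rlt_le _ _ (proj1 hR)) (proj2 hR).
  have hb : Cmod (G (RtoC 0)) <= K * R ^ m.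
    apply: is_mean_bound mG; first lra.
    move=> t ht; have ht1 : Cmod t < 1 by lra.
    rewrite /G -(mul_conj_circle ht).
    have -> : (t * Cconj t - Cconj z * t = t * Cconj (t - z))%C by rewrite Cminus_conj; ring.
    have -> : (psum q t * (t * Cconj (t - z)) ^ m = t ^ m * (psum q t * Cconj (t - z) ^ m))%C.
      by rewrite Cpow_mult_l; ring.
    rewrite Cmod_mult Cmod_pow ht Cmod_mult Cmod_pow Cmod_conj -Cmod_pow -Cmod_mult.
    rewrite (Cmult_comm (psum q t)) -eq // Rmult_comm.
    apply: Rmult_le_compat_r; first by apply: pow_le; lra.
    exact: hK.
  have hRm : 0 < R ^ m by apply: pow_lt; lra.
  move: hb; rewrite /G Cmult_0_r /Cminus Copp_0 Cplus_0_r Cmod_mult Cmod_pow Cmod_R.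
  rewrite Rabs_pos_eq; last exact: pow2_ge_0.
  rewrite -pow_mult (_ : R ^ (2 * m)%coq_nat = R ^ m * R ^ m); last first.
    by rewrite -pow_add; congr pow; lia.
  move=> hb; have hb2 : Cmod (psum q (RtoC 0)) * R ^ m <= K by nra.
  rewrite eq ?Cmod_0; last lra.
  rewrite Cmod_mult Cmod_pow /Cminus Cplus_0_l Cmod_opp /Rdiv Rpow_mult_distr pow_inv.
  have -> : Cmod z ^ m * Cmod (psum q (RtoC 0)) = (Cmod (psum q (RtoC 0)) * R ^ m) * (Cmod
    z ^ m * / R ^ m).
    by field; lra.
  apply: Rmult_le_compat_r hb2; apply: Rmult_le_pos; first exact: pow_le.
  by apply/Rlt_le/Rinv_0_lt_compat.
have hx : Rabs (Cmod z / R) < 1.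
  rewrite Rabs_pos_eq; last by apply: Rdiv_le_0_compat; lra.
  by apply/Rlt_div_l; lra.
have hl := is_lim_seq_scal_l _ K _ (is_lim_seq_geom _ hx); rewrite /= Rmult_0_r in hl.
have := is_lim_seq_le _ _ _ _ bnd (is_lim_seq_const _) hl => /= hle.
by apply: Cmod_eq_0; apply: Rle_antisym => //; exact: Cmod_ge_0.
Qed.

Lemma finite_order z a : tame a -> Cmod z < 1 -> psum a (RtoC 0) <> RtoC 0 ->
  exists m q, [/\ tame q, psum q z <> RtoC 0 &
    forall t, Cmod t < 1 -> psum a t = ((t - z) ^ m * psum q t)%C].
Proof.
move=> ha hz h0.
have [m hm] : exists m, psum (iquot z a m) z <> RtoC 0.
  apply: Classical_Prop.NNPP => h; apply: h0; apply: (infinite_order (z := z)) => // i.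
  by apply: Classical_Prop.NNPP => hi; apply: h; exists i.
elim: m {-2}m (leqnn m) hm => [|n IH] m hmn hm.
  exists m, (iquot z a m); split => //; first exact: tame_iquot.
  by move=> t ht; apply: psum_iquot => // i hi; lia.
case: (Classical_Prop.classic (exists i, (i < m)%nat /\ psum (iquot z a i) z <> RtoC 0)).
  by case=> i [hi hi2]; apply: (IH i) => //; lia.
move=> hno; exists m, (iquot z a m); split => //; first exact: tame_iquot.
move=> t ht; apply: psum_iquot => // i hi; apply: Classical_Prop.NNPP => hc.
by apply: hno; exists i.
Qed.


(** * Univalent functions and the powers of f(t)/t *)

Section Univalent.
Variables (f : C -> C) (c : nat -> C).
Hypothesis hf : univalent_normalized f c.

Definition series_coef (n : nat) : C := match n with 0%nat => RtoC 0 | n.+1 => ucoef c n end.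

Lemma f_series t : Cmod t < 1 -> is_Cseries (fun n => series_coef n * t ^ n)%C (f t).
Proof.
case: hf => _ [_ h] ht; apply: is_series_decr_1; apply: is_series_decr_1.
rewrite [X in is_series _ X](_ : _ = f t - t)%C; last by rewrite /plus /opp /=; ring.
by apply: is_series_ext (h t ht) => n.
Qed.

Lemma tame_f : tame series_coef.
Proof. exact: tame_of_series f_series. Qed.

Lemma tame_ucoef : tame (ucoef c).
Proof. exact: (tame_shift 1 tame_f). Qed.

Definition fquot : C -> C := psum (ucoef c).
Definition df : C -> C := psum (deriv series_coef).

Lemma f_psum t : Cmod t < 1 -> f t = psum series_coef t.
Proof. by move=> ht; apply/esym/psum_unique/f_series. Qed.

Lemma f_fquot t : Cmod t < 1 -> f t = (t * fquot t)%C.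
Proof. by move=> ht; rewrite f_psum // psum_rec //= ?Cplus_0_l //; exact: tame_f. Qed.

Lemma f_cdiff t : Cmod t < 1 -> cdiff f t (df t).
Proof.
move=> ht; have := psum_cdiff tame_f ht; apply: cder_ext_loc.
by apply: filter_imp (ann_open (disc_lt ht)) => s [_ hs]; rewrite f_psum.
Qed.

Lemma C_derive_f t : Cmod t < 1 -> C_derive f t = df t.
Proof. by move=> ht; apply: is_C_derive_unique; apply: cdiff_is_derive; apply: f_cdiff. Qed.

Lemma f_inj s t : Cmod s < 1 -> Cmod t < 1 -> f s = f t -> s = t.
Proof. by case: hf => _ [h _]; exact: h. Qed.

Lemma f_0 : f (RtoC 0) = RtoC 0.
Proof. by rewrite f_fquot ?Cmod_0; [ring | lra]. Qed.

Lemma fquot_0 : fquot (RtoC 0) = RtoC 1.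
Proof. by rewrite /fquot psum_rec ?Cmod_0 /=; [ring | exact: tame_ucoef | lra]. Qed.

Lemma fquot_neq0 t : Cmod t < 1 -> fquot t <> RtoC 0.
Proof.
move=> ht; case: (Ceq_dec t (RtoC 0)) => [->|h0 e].
  by rewrite fquot_0 => /RtoC_inj; lra.
by apply: h0; apply: f_inj; rewrite ?Cmod_0 ?f_0 ?f_fquot ?e //; [lra | ring].
Qed.

Lemma hol_fquot : hol disc fquot. Proof. exact: hol_psum tame_ucoef. Qed.
Lemma hol_df : hol disc df. Proof. exact: hol_psum (tame_deriv tame_f). Qed.

Definition power_kernel (p : Z) (t : C) : C := (df t ^ 2 * CpowZ (fquot t) (- p - 2))%C.

Lemma hol_power_kernel p : hol disc (power_kernel p).
Proof.
apply: hol_mult; first by apply: hol_pow; exact: hol_df.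
by apply: hol_CpowZ hol_fquot => t [_ ht]; exact: fquot_neq0.
Qed.

Lemma power_kernel_pred p t : Cmod t < 1 ->
  power_kernel (p - 1) t = (fquot t * power_kernel p t)%C.
Proof.
move=> ht; rewrite /power_kernel (_ : (- (p - 1) - 2 = (- p - 2) + 1)%Z); last by lia.
rewrite CpowZ_succ; [ring | exact: fquot_neq0].
Qed.

Lemma coefs_power_kernel_m2 : coefs (power_kernel (- 2)) (fun N => acoef_sum c N (- 2)).
Proof.
have h1 := coefs_mult (tame_deriv tame_f) (hol_const _ (RtoC 1)) coefs_one.
have h1' := hol_mult hol_df (hol_const _ (RtoC 1)).
have := coefs_mult (tame_deriv tame_f) h1' h1.
move=> /(coefs_ext (H' := power_kernel (- 2))) h2; apply: coefs_proper (h2 _) => [N|t ht].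
  rewrite acoef_sum_m2; apply: eq_bigr => i _; congr Cmult.
  rewrite big_ord_recr /= subnn big1 => [|j _].
    by rewrite /deriv; case: (N - i)%nat => [|n] /=; ring.
  by rewrite (_ : (N - i - j)%nat = (N - i - j.+1).+1) ?Cmult_0_r //; have := ltn_ord j; lia.
rewrite /power_kernel /= -/df; ring.
Qed.

Lemma coefs_power_kernel_pred p : coefs (power_kernel p) (fun N => acoef_sum c N p) ->
  coefs (power_kernel (p - 1)) (fun N => acoef_sum c N (p - 1)).
Proof.
move=> h; have := coefs_mult tame_ucoef (hol_power_kernel p) h.
move=> /(coefs_ext (H' := power_kernel (p - 1))) h2; apply: coefs_proper (h2 _) => [N|t ht].
  by rewrite acoef_sum_pred.
by rewrite power_kernel_pred.
Qed.

(** From p = -2 in both directions: down by multiplication with f(t)/t, up by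
cancelling that factor. *)
Lemma coefs_power_kernel p : coefs (power_kernel p) (fun N => acoef_sum c N p).
Proof.
have succ q : coefs (power_kernel (q - 1)) (fun N => acoef_sum c N (q - 1)) ->
  coefs (power_kernel q) (fun N => acoef_sum c N q).
  move=> h; have [b hb] := coefs_ex (hol_power_kernel q); apply: (coefs_proper _ hb).
  apply: (@conv_inj (ucoef c) b (fun N => acoef_sum c N q)) => // N; rewrite -acoef_sum_pred.
  apply: (@coefs_unique _ (fun N => _) _ N _ h);
    apply: coefs_ext (coefs_mult tame_ucoef (hol_power_kernel q) hb) => t ht.
  by rewrite power_kernel_pred.
have up n : coefs (power_kernel (- 2 + Z.of_nat n)) (fun N => acoef_sum c N (- 2 + Z.of_nat n)).
  elim: n => [|n IH]; first exact: coefs_power_kernel_m2.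
  by apply: succ; rewrite (_ : (- 2 + Z.of_nat n.+1 - 1 = - 2 + Z.of_nat n)%Z) //; lia.
have down n : coefs (power_kernel (- 2 - Z.of_nat n)) (fun N =>
  acoef_sum c N (- 2 - Z.of_nat n)).
  elim: n => [|n IH]; first exact: coefs_power_kernel_m2.
  by have := coefs_power_kernel_pred IH; rewrite (_
    : (- 2 - Z.of_nat n - 1 = - 2 - Z.of_nat n.+1)%Z) //; lia.
case: (Z.le_gt_cases (- 2) p) => h.
  by have := up (Z.to_nat (p + 2)); rewrite (_
    : (- 2 + Z.of_nat (Z.to_nat (p + 2)) = p)%Z) //; lia.
by have := down (Z.to_nat (- 2 - p)); rewrite (_
  : (- 2 - Z.of_nat (Z.to_nat (- 2 - p)) = p)%Z) //; lia.
Qed.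

(** * The contour integral *)

Section Integral.
Variables (k : nat) (z : C).
Hypothesis hk : (1 <= k)%nat.
Hypothesis hz : Cmod z < 1.
Let w := f z.

(** This is t times the integrand of the tangent vector, without the factor
w^2, since dt = i t d theta; the factor f(t)^2 is written t^2 (f(t)/t)^2. *)
Definition integrand (t : C) : C := (df t ^ 2 * / (t ^ k * fquot t ^ 2 * (f t - f z)))%C.

Lemma f_sub_neq0 t : Cmod t < 1 -> Cmod t <> Cmod z -> (f t - f z)%C <> RtoC 0.
Proof.
move=> ht hne e; apply: hne; congr Cmod; apply: f_inj => //.
have -> : f t = (f t - f z + f z)%C by ring.
by rewrite e; ring.
Qed.

Lemma hol_f : hol disc f.
Proof.
apply: hol_ext (hol_mult (hol_id _) hol_fquot) => t [_ ht]; by rewrite f_fquot.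
Qed.

Lemma CpowZ_1k t : t <> RtoC 0 -> (t * CpowZ t (1 - Z.of_nat k) * t ^ k = t * t)%C.
Proof.
move=> h0; case: k hk => [//|n] _.
rewrite (_ : (1 - Z.of_nat n.+1 = - Z.of_nat n)%Z); last lia.
by rewrite CpowZ_opp //= ; field; apply: Cpow_nz.
Qed.

Lemma L_minus_mean r l : Cmod z < r -> r < 1 -> is_mean integrand r l ->
  L_minus k f r z = (w ^ 2 * l)%C.
Proof.
move=> hr hr1 hl; have h0 := Cmod_ge_0 z; rewrite /L_minus /kirillov_field /circle_integral.
have hm : is_mean (fun t => C_derive f t ^ 2 * CpowZ t (1 - Z.of_nat k) / (f t ^ 2 * (f t -
  f z)) * (Ci * t))%C r (Ci * l)%C.
  apply: is_mean_ext (is_mean_scal (a := Ci) hl); first lra.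
  move=> t ht; have ht1 : Cmod t < 1 by lra.
  have t0 : t <> RtoC 0 by apply: Cneq0_Cmod; lra.
  have hd : (f t - f z)%C <> RtoC 0 by apply: f_sub_neq0 => //; lra.
  have hg := fquot_neq0 ht1; have hp := Cpow_nz t k t0.
  rewrite C_derive_f // /integrand (f_fquot ht1); rewrite (f_fquot ht1) in hd.
  move: (CpowZ_1k t0); move: (CpowZ _ _) (df t) (fquot t) (t ^ k)%C (f z) hg hp hd =>
    P F G neg_remainder W hg hp hd hT.
  have -> : P = (t * P * neg_remainder * / (t * neg_remainder))%C by field.
  by rewrite hT; field.
rewrite (is_RInt_unique (V := C_R_CompleteNormedModule) _ _ _ _ hm).
rewrite RtoC_mult /w; have := twopi_neq0; rewrite RtoC_mult.
move: (RtoC PI) => p hp.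
have hp0 : p <> RtoC 0 by move=> e; apply: hp; rewrite e; ring.
have h2 : RtoC 2 <> RtoC 0 by move=> /RtoC_inj; lra.
have hi : Ci <> RtoC 0 by move=> e; have := Cmod_Ci; rewrite e Cmod_0; lra.
by field.
Qed.

Lemma hol_integrand : hol (ann (Cmod z) 1) integrand.
Proof.
have hd t : ann (Cmod z) 1 t -> disc t by apply: ann_sub; have := Cmod_ge_0 z; lra.
apply: hol_mult; first by apply: hol_pow; apply: hol_sub hd hol_df.
apply: hol_inv => [t [h1 h2]|].
  have t0 : t <> RtoC 0 by apply: Cneq0_Cmod; have := Cmod_ge_0 z; lra.
  apply: Cmult_neq_0; last by apply: f_sub_neq0; lra.
  by apply: Cmult_neq_0; apply: Cpow_nz => //; exact: fquot_neq0.
apply: hol_mult; last by apply: hol_minus; [apply: (hol_sub hd hol_f) | exact: hol_const].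
by apply: hol_mult; apply: hol_pow; [exact: hol_id | apply: (hol_sub hd hol_fquot)].
Qed.

(** 1/(f - w) = 1/f + (w/f) / (f - w), used n+1 times.  The terms split off are
w^j f'^2 (f/t)^(-j-3) t^(-k-j-1), of which the mean is a Taylor coefficient of
[power_kernel (j+1)]. *)
Lemma mean_terms_pos rho l n : 0 < rho < 1 -> Cmod z < rho -> is_mean integrand rho l ->
  is_mean (fun t => integrand t * (w / f t) ^ n.+1)%C rho
   (l - sum_n (G := C_AbelianMonoid) (fun j =>
     acoef_sum c (j + k + 1) (Z.of_nat j + 1) * w ^ j)%C n)%C.
Proof.
move=> hr hzr hl.
have step m l' : is_mean (fun t => integrand t * (w / f t) ^ m)%C rho l' ->
    is_mean (fun t => integrand t * (w / f t) ^ m.+1)%C rho (l' + - (1) * (w ^ m *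
      acoef_sum c (m + k + 1) (Z.of_nat m + 1)))%C.
  move=> h; have hA := @coefs_power_kernel (Z.of_nat m + 1) rho (m + k + 1)%nat hr.
  apply: is_mean_ext (is_mean_plus h (is_mean_scal (a := (- (1))%C) (is_mean_scal (a := (w
    ^ m)%C) hA))); first lra.
  move=> t ht; have ht1 : Cmod t < 1 by lra.
  have t0 : t <> RtoC 0 by apply: Cneq0_Cmod; lra.
  have hd : (f t - f z)%C <> RtoC 0 by apply: f_sub_neq0 => //; lra.
  have hg := fquot_neq0 ht1.
  rewrite /integrand /power_kernel (_ : (- (Z.of_nat m + 1) - 2 = - Z.of_nat (m + 3))%Z);
    last lia.
  rewrite CpowZ_opp // (_ : (m + k + 1 = m + (k + 1))%nat); last lia.
  have -> : (t ^ (m + (k + 1))%nat = t ^ m * (t ^ k * t))%C.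
    by rewrite (Cpow_add_r t m (k + 1)) (Cpow_add_r t k 1) /=; ring.
  rewrite (Cpow_add_r (fquot t) m 3) -/w in hd *.
  have hf0 : f t <> RtoC 0 by rewrite f_fquot //; apply: Cmult_neq_0.
  have e : ((w / f t) ^ m = w ^ m * / (t ^ m * fquot t ^ m))%C.
    by rewrite /Cdiv Cpow_mult_l Cpow_inv // {1}f_fquot // Cpow_mult_l.
  rewrite (Cpow_S (w / f t) m) e.
  rewrite (f_fquot ht1) in hd hf0 *.
  have := Cpow_nz _ m t0; have := Cpow_nz _ k t0; have := Cpow_nz _ m hg.
  move: (fquot t) hg hd hf0 => G hg hd hf0;
    move: w hd (t ^ m)%C (t ^ k)%C (G ^ m)%C (w ^ m)%C (df t) => W hd Tm Tk Gm Wm F hGm hTk hTm.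
  by rewrite /=; field.
elim: n => [|n IH].
  rewrite sum_O; have h := step 0%nat l.
  rewrite (_ : (l - _ = l + - (1) * (w ^ 0 * acoef_sum c (0 + k + 1) (Z.of_nat 0 + 1)))%C);
    last by ring.
  by apply: h; apply: is_mean_ext hl; [lra | move=> t _ /=; ring].
rewrite sum_Sn; have := step n.+1 _ IH.
set s := sum_n _ _; set A := acoef_sum _ _ _.
by rewrite (_ : (l - plus s (A * w ^ n.+1) = l - s + - (1) * (w ^ n.+1 * A))%C) // /plus
  /=; move: (w * _)%C => u; ring.
Qed.
(** The remainder after n terms of the expansion of 1/(f - w) in powers of
f/w. *)
Definition neg_remainder (n : nat) (t : C)
  : C := (df t ^ 2 * f t ^ n * / (t ^ k * fquot t ^ 2 * w ^ n * (f t - f z)))%C.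

(** 1/(f - w) = - 1/w + (f/w) / (f - w), used n times.  The terms split off are
f'^2 (f/t)^(j-2) t^(j-k) / w^(j+1), of which the mean is a Taylor coefficient of
[power_kernel (-j)]. *)
Lemma mean_terms_neg rho l n : z <> RtoC 0 -> 0 < rho -> rho < Cmod z -> (n <= k.+1)%nat ->
  is_mean integrand rho l ->
  is_mean (neg_remainder n) rho
   (l + \big[Cplus/RtoC 0]_(j < n) (acoef_sum c (k - j) (- Z.of_nat j) * / w ^ j.+1))%C.
Proof.
move=> z0 hr hrz hn hl.
have w0 : w <> RtoC 0 by rewrite /w f_fquot //; apply: Cmult_neq_0 => //; exact: fquot_neq0.
elim: n hn => [|n IH] hn.
  rewrite big_ord0 Cplus_0_r; apply: is_mean_ext hl; first lra.
  by move=> t ht; rewrite /neg_remainder /integrand /= !Cmult_1_r.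
have hr1 : 0 < rho < 1 by lra.
have hA := @coefs_power_kernel (- Z.of_nat n) rho (k - n)%nat hr1.
rewrite big_ord_recr /= Cplus_assoc.
have := is_mean_plus (IH (ltnW hn)) (is_mean_scal (a := (/ w ^ n.+1)%C) hA).
rewrite (Cmult_comm (/ _)); apply: is_mean_ext; first lra.
move=> t ht; have ht1 : Cmod t < 1 by lra.
have t0 : t <> RtoC 0 by apply: Cneq0_Cmod; lra.
have hd : (f t - f z)%C <> RtoC 0 by apply: f_sub_neq0 => //; lra.
have hg := fquot_neq0 ht1.
have eP : CpowZ (fquot t) (- - Z.of_nat n - 2) = (fquot t ^ n * / fquot t ^ 2)%C.
  case: n {IH hn hA} => [|[|n]].
  - by rewrite /=; field.
  - by rewrite /=; field.
  - rewrite (_ : (- - Z.of_nat n.+2 - 2 = Z.of_nat n)%Z); last lia.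
    by rewrite CpowZ_nat /=; field.
rewrite /neg_remainder /power_kernel eP -(Cpow_sub (i := n) (N := k) t0) //;
  rewrite -/w in hd *.
have -> : (f t ^ n.+1 = f t * (t ^ n * fquot t ^ n))%C
  by rewrite Cpow_S {2}f_fquot // Cpow_mult_l.
have -> : (f t ^ n = (t ^ n * fquot t ^ n))%C by rewrite f_fquot // Cpow_mult_l.
have := Cpow_nz _ k t0; have := Cpow_nz _ n w0; rewrite (Cpow_S w n).
move: (t ^ n)%C (t ^ k)%C (fquot t ^ n)%C (w ^ n)%C => Tn Tk Gn Wn.
move: (df t) (f t) (fquot t) w hg hd w0 => F Ft G W hg hd w0 hWn hTk.
by rewrite /=; field.
Qed.

(** The factor f^(k+1) cancels the pole t^(-k) and leaves a zero at t = 0. *)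
Lemma mean_neg_remainder_last rho : z <> RtoC 0 -> 0 < rho -> rho < Cmod z ->
  is_mean (neg_remainder k.+1) rho (RtoC 0).
Proof.
move=> z0 hr hrz.
have w0 : w <> RtoC 0 by rewrite /w f_fquot //; apply: Cmult_neq_0 => //; exact: fquot_neq0.
have hd t : ann (-1) (Cmod z) t -> disc t by apply: ann_sub; lra.
pose G t := (t * (df t ^ 2 * fquot t ^ k.+1 * / (fquot t ^ 2 * w ^ k.+1 * (f t - f z))))%C.
have hG : hol (ann (-1) (Cmod z)) G.
  apply: hol_mult; first exact: hol_id.
  have hhg := hol_sub hd hol_fquot; have hhf := hol_sub hd hol_f; have hh1 := hol_sub hd hol_df.
  apply: hol_mult; first by apply: hol_mult; apply: hol_pow.
  apply: hol_inv => [t [h1 h2]|].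
    apply: Cmult_neq_0; last by apply: f_sub_neq0; lra.
    apply: Cmult_neq_0; last exact: Cpow_nz.
    by apply: Cpow_nz; apply: fquot_neq0; lra.
  apply: hol_mult; last by apply: hol_minus => //; exact: hol_const.
  by apply: hol_mult; [exact: hol_pow | exact: hol_const].
have := mean_disc hG (Rlt_le _ _ hr) hrz; rewrite {2}/G Cmult_0_l.
apply: is_mean_ext; first lra.
move=> t ht; have ht1 : Cmod t < 1 by lra.
have t0 : t <> RtoC 0 by apply: Cneq0_Cmod; lra.
have hd' : (f t - f z)%C <> RtoC 0 by apply: f_sub_neq0 => //; lra.
have hg := fquot_neq0 ht1.
have e : (f t ^ k.+1 = t ^ k.+1 * fquot t ^ k.+1)%C by rewrite f_fquot // Cpow_mult_l.
rewrite /G /neg_remainder e (Cpow_S t k).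
have := Cpow_nz _ k t0; have := Cpow_nz _ k.+1 w0.
move: (t ^ k)%C (fquot t ^ k.+1)%C (w ^ k.+1)%C => Tk Gk Wk.
move: (df t) (f t) (fquot t) (f z) hg hd' => F Ft G' W hg hd' h1 h2.
by rewrite /=; field.
Qed.

Lemma cdiff_sub t : cdiff (fun s => s - z)%C t (RtoC 1).
Proof.
have := cder_plus (cder_e (T := C_UniformSpace) (fun s : C => s) t)
   (cder_const (fun s : C => s) t (- z)%C).
by rewrite Cplus_0_r.
Qed.

Lemma cdiff_pow_sub t m : cdiff (fun s => (s - z) ^ m.+1)%C t (INR m.+1 * (t - z) ^ m)%C.
Proof.
elim: m => [|m IH].
  have := cder_mult (cont_id t) (cdiff_sub t) (cder_const (fun s : C => s) t (RtoC 1)).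
  by congr (cdiff _ _ _); rewrite /=; ring.
have := cder_mult (cont_id t) (cdiff_sub t) IH.
congr (cdiff _ _ _); rewrite (S_INR m.+1) RtoC_plus Cpow_S; ring.
Qed.

Lemma cdiff_unique G t l l' : cdiff G t l -> cdiff G t l' -> l = l'.
Proof.
by move=> /cdiff_is_derive/is_C_derive_unique <- /cdiff_is_derive/is_C_derive_unique <-.
Qed.

(** With f - w = (t - z)^m q one has f' = (t - z)^(m-1) u, where
u = m q + (t - z) q'.  Hence the integrand is P(t)/(t - z) with
P = f' u / (t^k (f/t)^2 q), and P(z) is m f'(z) / (z^k (f(z)/z)^2). *)
Lemma mean_integrand_cross rho r l : 0 < rho -> rho < Cmod z -> Cmod z < r -> r < 1 ->
  is_mean integrand rho l ->
  is_mean integrand r (l + df z * / (z ^ k * fquot z ^ 2) * / z)%C.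
Proof.
move=> hr hrz hzr hr1 hl.
have z0 : z <> RtoC 0 by apply: Cneq0_Cmod; lra.
have w0 : w <> RtoC 0 by rewrite /w f_fquot //; apply: Cmult_neq_0 => //; exact: fquot_neq0.
pose a n := (series_coef n + (- w) * (if n is 0%nat then RtoC 1 else RtoC 0))%C.
have t1 : tame (fun n => if n is 0%nat then RtoC 1 else RtoC 0).
  move=> s hs; exists 1 => -[|n]; rewrite ?Cmod_1 ?Cmod_0 /=; lra.
have s1 t : Cmod t < 1 -> psum (fun n => if n is 0%nat then RtoC 1 else RtoC 0) t = RtoC 1.
  move=> ht; rewrite psum_rec //.
  have -> : psum (shift 1 (fun n => if n is 0%nat then RtoC 1 else RtoC 0)) t = RtoC 0;
    last by ring.
  apply: psum_unique; apply: (is_series_ext (fun _ => RtoC 0)) => [n|]; first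
    by rewrite /shift /=; ring.
  apply/Cseries_lim; apply: (is_lim_seq_ext (fun _ => 0)); last exact: is_lim_seq_const.
  move=> n; rewrite (_ : (_ - _)%C = RtoC 0) ?Cmod_0 //.
  elim: n => [|n IH]; first by rewrite sum_O; ring.
  by rewrite sum_Sn /plus /= -[X in X = _]/(sum_n (G := C_AbelianMonoid) (fun=> RtoC 0) n +
    0 - 0)%C Cplus_0_r.
have ta : tame a by apply: tame_plus (tame_f) _; apply: tame_scal.
have ea t : Cmod t < 1 -> psum a t = (f t - f z)%C.
  move=> ht; rewrite psum_plus // ?psum_scal // ?s1 // -?f_psum // -/w;
    [ring | exact: tame_f | exact: tame_scal].
have a0 : psum a (RtoC 0) <> RtoC 0.
  rewrite ea ?Cmod_0 ?f_0; last lra.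
  by move=> e; apply: w0; rewrite /w (_ : f z = - (RtoC 0 - f z))%C; [rewrite e; ring | ring].
have [[|m] [q [tq qz eq]]] := finite_order ta hz a0.
  by case: qz; have := eq z hz; rewrite ea //= Cmult_1_l => <-; ring.
have {}eq t : Cmod t < 1 -> (f t - f z = (t - z) ^ m.+1 * psum q t)%C by move=> ht;
  rewrite -ea ?eq.
have q0 t : Cmod t < 1 -> psum q t <> RtoC 0.
  move=> ht; case: (Ceq_dec t z) => [->//|hne e]; apply: hne; apply: f_inj => //.
  have := eq t ht; rewrite e Cmult_0_r => e2.
  have -> : f t = (f t - f z + f z)%C by ring.
  rewrite e2; ring.
pose u t := (INR m.+1 * psum q t + (t - z) * psum (deriv q) t)%C.
have ef t : Cmod t < 1 -> df t = ((t - z) ^ m * u t)%C.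
  move=> ht; apply: cdiff_unique (f_cdiff ht) _.
  have := cder_plus (cder_const (fun s : C => s) t (f z))
    (cder_mult (cont_id t) (cdiff_pow_sub t m) (psum_cdiff tq ht)).
  move=> h; apply: cder_ext_loc; last first.
    by move: h; congr (cdiff _ _ _); rewrite /u Cpow_S; ring.
  apply: filter_imp (ann_open (disc_lt ht)) => s [_ hs].
  rewrite -eq //; ring.
pose P t := (df t * u t * / (t ^ k * fquot t ^ 2 * psum q t))%C.
have hz1 : ann 0 1 z by rewrite /ann; lra.
have dP : dquot_hol 0 1 z P.
  have dpsum b : tame b -> dquot_hol 0 1 z (psum b) by move=> tb; apply: dquot_hol_psum =>
    //; lra.
  apply: dquot_hol_mult.
    apply: dquot_hol_mult; first exact/dpsum/tame_deriv/tame_f.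
    apply: dquot_hol_plus; first by apply: dquot_hol_mult;
      [exact: dquot_hol_const | exact: dpsum].
    apply: dquot_hol_mult; last exact/dpsum/tame_deriv.
    by apply: dquot_hol_plus; [exact: dquot_hol_id | exact: dquot_hol_const].
  apply: dquot_hol_inv => // [t [h1 h2]|].
    have t0 : t <> RtoC 0 by apply: Cneq0_Cmod.
    apply: Cmult_neq_0; last exact: q0.
    by apply: Cmult_neq_0; apply: Cpow_nz => //; exact: fquot_neq0.
  apply: dquot_hol_mult; last exact: dpsum.
  by apply: dquot_hol_mult; apply: dquot_hol_pow;
    [exact: dquot_hol_id | exact/dpsum/tame_ucoef].
have eE t : 0 < Cmod t -> Cmod t < 1 -> Cmod t <> Cmod z -> (P t * / (t - z) = integrand t)%C.
  move=> h0 ht hne; have t0 := Cneq0_Cmod h0.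
  have hd : (t - z)%C <> RtoC 0 by apply: Csub_neq0.
  have hg := fquot_neq0 ht; have hq := q0 t ht.
  rewrite /integrand eq // /P (ef t ht) /=; have := Cpow_nz _ k t0; have := Cpow_nz _ m hd.
  move: (t ^ k)%C ((t - z) ^ m)%C (t - z)%C (u t) (fquot t) (psum q t) hd hg hq =>
    Tk Dm D U G Q hd hg hq h1 h2.
  by field.
have m1 : is_mean (fun t => P t * / (t - z))%C rho l.
  apply: is_mean_ext hl; first lra.
  by move=> t ht; rewrite eE // ht; lra.
have := mean_cross hr hrz hzr hr1 dP m1.
have eP : P z = (df z * / (z ^ k * fquot z ^ 2))%C.
  have e0 : (z - z = RtoC 0)%C by ring.
  have hq := q0 z hz; have hg := fquot_neq0 hz; have := Cpow_nz _ k z0.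
  (* for a simple zero the factor m is 1, for a multiple one f' vanishes at z *)
  have e1 : df z = (INR m.+1 * df z)%C.
    have := ef z hz; rewrite e0; move: (df z) (u z) => F v.
    by case: (m) => [|m'] e; rewrite ?e /=; ring.
  rewrite /P /u e0 Cmult_0_l Cplus_0_r.
  have -> : (df z * (INR m.+1 * psum q z) = df z * psum q z)%C by rewrite {2}e1; ring.
  move: (z ^ k)%C (df z) (fquot z) (psum q z) hg hq => Zk F G Q hg hq h1.
  by field.
rewrite eP; apply: is_mean_ext; first lra.
by move=> t ht; rewrite eE // ht; lra.
Qed.

Lemma L_minus_neg r : z <> RtoC 0 -> Cmod z < r -> r < 1 ->
  L_minus k f r z =
       (CpowZ z (1 - Z.of_nat k) * C_derive f z
        - \big[Cplus/RtoC 0]_(j < k.+1)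
            (acoef_sum c (k - j)%nat (- Z.of_nat j)%Z
             * CpowZ (f z) (1 - Z.of_nat j)%Z))%C.
Proof.
move=> z0 hzr hr1; have hz0 : 0 < Cmod z by apply/Cmod_gt_0.
have w0 : w <> RtoC 0 by rewrite /w f_fquot //; apply: Cmult_neq_0 => //; exact: fquot_neq0.
pose rho := Cmod z / 2; have hr : 0 < rho by rewrite /rho; lra.
have hrz : rho < Cmod z by rewrite /rho; lra.
have [l hl] : exists l, is_mean integrand rho l.
  have hT := mean_neg_remainder_last z0 hr hrz.
  have hs t : ann 0 (Cmod z) t -> disc t by apply: ann_sub; lra.
  apply: (hol_mean (a := 0) (b := Cmod z)); try lra.
  apply: hol_mult; first by apply: hol_pow; apply: hol_sub hs hol_df.
  apply: hol_inv => [t [h1 h2]|].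
    have t0 : t <> RtoC 0 by apply: Cneq0_Cmod.
    apply: Cmult_neq_0; last by apply: f_sub_neq0; lra.
    by apply: Cmult_neq_0; apply: Cpow_nz => //; apply: fquot_neq0; lra.
  apply: hol_mult; last by apply: hol_minus; [apply: (hol_sub hs hol_f) | exact: hol_const].
  by apply: hol_mult; apply: hol_pow; [exact: hol_id | apply: (hol_sub hs hol_fquot)].
have e := is_mean_unique (mean_neg_remainder_last z0 hr hrz) (mean_terms_neg z0 hr hrz
  (leqnn _) hl).
rewrite (L_minus_mean hzr hr1 (mean_integrand_cross hr hrz hzr hr1 hl)) C_derive_f //.
have -> : (\big[Cplus/RtoC 0]_(j < k.+1) (acoef_sum c (k - j) (- Z.of_nat j) * CpowZ (f z)
  (1 - Z.of_nat j))
   = w ^ 2 * \big[Cplus/RtoC 0]_(j < k.+1) (acoef_sum c (k - j) (- Z.of_nat j) * / w ^ j.+1))%C.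
  rewrite big_distrr; apply: eq_bigr => j _.
  rewrite (_ : (1 - Z.of_nat j = - Z.of_nat j + 1)%Z); last lia.
  rewrite CpowZ_succ // CpowZ_opp // -/w [RHS]/=; have := Cpow_nz _ j w0.
  by move: (w ^ j)%C (acoef_sum _ _ _) => Wj A h; field.
move: e; set S := \big[_/_]_(_ < _) _ => e.
have -> : l = (- S)%C.
  by apply: (@eq_trans _ _ (l + S - S)%C); [ring | rewrite -e; ring].
have hg := fquot_neq0 hz.
have hk0 := Cpow_nz _ k z0; have := CpowZ_1k z0; rewrite /w (f_fquot hz).
move: (CpowZ _ _) (z ^ k)%C (df z) (fquot z) hk0 hg => Pz Zk F G hk0 hg eP.
have -> : Pz = (z * Pz * Zk * / (z * Zk))%C by field.
by rewrite eP; field.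
Qed.
End Integral.

Lemma fquot_near_1 : exists d, 0 < d < 1 /\ forall t, Cmod t < d ->
  Cmod (fquot t - 1)%C < 1 / 2.
Proof.
have h0 : Cmod (RtoC 0) < 1 by rewrite Cmod_0; lra.
have h2 : 0 < 1 / 2 by lra.
case: (locally_CmodE (cont_eps h2 (psum_cont tame_ucoef h0))) => d [hd h].
exists (Rmin d (1 / 2)); split.
  by split; [apply: Rmin_pos | apply: Rle_lt_trans (Rmin_r _ _) _; lra].
move=> t ht; rewrite -fquot_0; apply: h; rewrite /Cminus Copp_0 Cplus_0_r.
exact: Rlt_le_trans ht (Rmin_l _ _).
Qed.

(** On a small fixed circle |t| = rho, f(t)/t is close to 1, so that
|f(t)| >= rho/2, whereas |w| <= rho/4 for |z| < rho/8; the geometric series then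
converges at rate 1/2. *)
Lemma L_minus_pos (k : nat) : (1 <= k)%nat -> exists eps : R, 0 < eps /\
     forall (z : C) (r : R), Cmod z < eps -> Cmod z < r < 1 ->
       is_Cseries
         (fun j : nat =>
            (acoef_sum c (j + k + 1)%nat (Z.of_nat j + 1)%Z * f z ^ (j + 2)%nat)%C)
         (L_minus k f r z).
Proof.
move=> hk; case: fquot_near_1 => d [hd hg1].
pose rho := d / 2; have hr : 0 < rho < 1 by rewrite /rho; lra.
exists (rho / 8); split; first lra.
move=> z r hz1 [hzr hr1]; have hz : Cmod z < 1 by lra.
have hzrho : Cmod z < rho by lra.
have hw : Cmod (f z) <= rho / 4.
  rewrite f_fquot // Cmod_mult.
  have h1 : Cmod z < d by rewrite /rho in hzrho; lra.
  have h3 := Cmod_le_sub (fquot z) (RtoC 1).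
  have h4 := hg1 z h1; rewrite Cmod_1 in h3.
  have h5 : Cmod (1 - fquot z)%C = Cmod (fquot z - 1)%C by rewrite -Cmod_opp; congr Cmod; ring.
  have := Cmod_ge_0 z; have := Cmod_ge_0 (fquot z); nra.
have hz0 := Cmod_ge_0 z.
have [l hl] : exists l, is_mean (integrand k z) rho l
  by apply: hol_mean (hol_integrand k hz) _ _; lra.
have hlr : is_mean (integrand k z) r l
  by apply: mean_const (hol_integrand k hz) _ _ _ _ hl; lra.
rewrite (L_minus_mean hk hz hzr hr1 hlr).
have hfl t : Cmod t = rho -> rho / 2 <= Cmod (f t).
  move=> ht; have ht1 : Cmod t < 1 by lra.
  rewrite f_fquot // Cmod_mult ht.
  have h1 : Cmod t < d by rewrite ht /rho; lra.
  have h3 := Cmod_le_sub (RtoC 1) (fquot t); have := hg1 t h1; rewrite Cmod_1 in h3; nra.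
have [K hK] : exists K, forall t, Cmod t = rho -> Cmod (integrand k z t) <= K.
  set s := (1 + rho) / 2; have hs : 0 < s < 1 by rewrite /s; lra.
  case: (tame_deriv tame_f hs) => M hM; set K1 := M * / (1 - rho / s).
  exists (K1 ^ 2 * / (rho ^ k * (1 / 2) ^ 2 * (rho / 4))) => t ht; have ht1 : Cmod t < 1 by lra.
  have t0 : t <> RtoC 0 by apply: Cneq0_Cmod; lra.
  have b1 : Cmod (df t) <= K1.
    rewrite /K1 -ht; apply: psum_bound => //; last exact/tame_deriv/tame_f.
    by rewrite ht /s; lra.
  have b2 : 1 / 2 <= Cmod (fquot t).
    have h1 : Cmod t < d by rewrite ht /rho; lra.
    by have h3 := Cmod_le_sub (RtoC 1) (fquot t); have := hg1 t h1; rewrite Cmod_1 in h3; lra.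
  have b3 : rho / 4 <= Cmod (f t - f z)%C.
    have := Cmod_le_sub (f t) (f z); have := hfl t ht.
    rewrite (_ : Cmod (f z - f t)%C = Cmod (f t - f z)%C); first lra.
    by rewrite -Cmod_opp; congr Cmod; ring.
  have hp : 0 < rho ^ k by apply: pow_lt; lra.
  have hne : (f t - f z)%C <> RtoC 0 by apply: f_sub_neq0 => //; lra.
  rewrite /integrand (Cmod_mult (df t ^ 2)%C) Cmod_inv; last first.
    by do 2?[apply: Cmult_neq_0 => //]; apply: Cpow_nz => //; exact: fquot_neq0.
  rewrite (Cmod_mult (t ^ k * _)%C) (Cmod_mult (t ^ k)%C) !Cmod_pow ht.
  apply: Rmult_le_compat.
  - exact: pow2_ge_0.
  - apply/Rlt_le/Rinv_0_lt_compat; do 2?[apply: Rmult_lt_0_compat => //]; try lra.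
    by apply: pow_lt; lra.
  - by apply: pow_incr; split => //; exact: Cmod_ge_0.
  apply: Rinv_le_contravar.
    by do 2?[apply: Rmult_lt_0_compat => //]; try lra; apply: pow_lt; lra.
  apply: Rmult_le_compat; [by apply: Rmult_le_pos;
    [lra | exact: pow2_ge_0] | lra | | exact: b3].
  by apply: Rmult_le_compat_l; [lra | apply: pow_incr; lra].
(* the remainder after n terms is at most K / 2^(n+1) *)
apply/Cseries_lim.
have bnd n : Cmod (sum_n (G := C_AbelianMonoid)
     (fun j => acoef_sum c (j + k + 1) (Z.of_nat j + 1) * f z ^ (j + 2)%nat)%C n - f z ^ 2
       * l)%C
   <= Cmod (f z) ^ 2 * K * (1 / 2) ^ n.+1.
  have hm := mean_terms_pos (n := n) hk hz hr hzrho hl.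
  have hb : Cmod (l - sum_n (G := C_AbelianMonoid) (fun j =>
    acoef_sum c (j + k + 1) (Z.of_nat j + 1) * f z ^ j)%C n)%C
      <= K * (1 / 2) ^ n.+1.
    apply: is_mean_bound hm; first lra.
    move=> t ht; rewrite Cmod_mult Cmod_pow.
    have hf0 := hfl t ht.
    have ft0 : f t <> RtoC 0 by apply: Cneq0_Cmod; lra.
    apply: Rmult_le_compat; [exact: Cmod_ge_0 | by apply: pow_le;
      exact: Cmod_ge_0 | exact: hK |].
    apply: pow_incr; split; first exact: Cmod_ge_0.
    rewrite Cmod_div //; apply/Rle_div_l; lra.
  rewrite (_ : (_ - _)%C = (- (f z ^ 2) * (l - sum_n (G := C_AbelianMonoid)
      (fun j => acoef_sum c (j + k + 1) (Z.of_nat j + 1) * f z ^ j) n))%C); last first.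
    rewrite (sum_n_ext _ (fun j => scal (K := C_Ring) (V := C_ModuleSpace) (f z ^ 2)%C
      (acoef_sum c (j + k + 1) (Z.of_nat j + 1) * f z ^ j)%C)).
      by rewrite sum_n_scal_l /scal /= /mult /=; move: (sum_n _ _) => S; ring.
    move=> j; rewrite /scal /= /mult /=.
    by rewrite (Cpow_add_r (f z) j 2) /=; ring.
  rewrite Cmod_mult Cmod_opp Cmod_pow Rmult_assoc.
  by apply: Rmult_le_compat_l hb; exact: pow2_ge_0.
have hx : Rabs (1 / 2) < 1 by rewrite Rabs_pos_eq; lra.
have hl0 := is_lim_seq_scal_l _ (Cmod (f z) ^ 2 * K) _ (proj1 (is_lim_seq_incr_1 _ _)
  (is_lim_seq_geom _ hx)).
rewrite /= Rmult_0_r in hl0.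
apply: (is_lim_seq_le_le (fun _ => 0) _ _ _ _ (is_lim_seq_const _) hl0) => n.
by split; [exact: Cmod_ge_0 | exact: bnd].
Qed.
End Univalent.

Theorem proposition3p2 (k : nat) (f : C -> C) (c : nat -> C)
    (hk : (1 <= k)%nat) (hf : univalent_normalized f c) :
  (exists eps : R, (0 < eps)%R /\
     forall (z : C) (r : R), (Cmod z < eps)%R -> (Cmod z < r < 1)%R ->
       is_series (K := C_AbsRing) (V := C_NormedModule)
         (fun j : nat =>
            (acoef_sum c (j + k + 1)%nat (Z.of_nat j + 1)%Z * f z ^ (j + 2)%nat)%C)
         (L_minus k f r z)) /\
  (forall (z : C) (r : R), (0 < Cmod z)%R -> (Cmod z < r < 1)%R ->
     L_minus k f r z =
       (CpowZ z (1 - Z.of_nat k)%Z * C_derive f z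
        - \big[Cplus/RtoC 0]_(j < k.+1)
            (acoef_sum c (k - j)%nat (- Z.of_nat j)%Z
             * CpowZ (f z) (1 - Z.of_nat j)%Z))%C).
Proof.
split; first exact: (L_minus_pos hf hk).
move=> z r hz0 [hzr hr1]; apply: (L_minus_neg hf hk) => //; last exact: Cneq0_Cmod.
lra.
Qed.
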